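(* For all $d\ge 2$, $\beta_{\mathrm{HK}}^d<\beta_{\mathrm{TSP}}^d$.
   Context: Let $x_1,x_2,\dots$ be independent uniformly random points of $[0,1]^d$ and $\mathcal{X}_n=\{x_1,\dots,x_n\}$. $\mathrm{TSP}(X)$ is the minimum Euclidean length of a traveling salesperson tour (closed Hamiltonian cycle) through the finite set $X$. $\mathrm{HK}(X)$ is the optimal value of the Held-Karp linear programming relaxation on $V=X$: minimize $\sum_{\{i,j\}\subseteq V}c_{\{ij\}}x_{\{ij\}}$, where $c_{\{ij\}}$ is the Euclidean distance between $i$ and $j$, subject to $\sum_{j\ne i}x_{\{ij\}}=2$ for all $i\in V$; $\sum_{\{i,j\}\subseteq S}x_{\{ij\}}\le |S|-1$ for all $\emptyset\ne S\subsetneq V$; and $0\le x_{\{ij\}}\le 1$ for all pairs. For $L\in\{\mathrm{TSP},\mathrm{HK}\}$, $\beta_L^d$ is the constant such that $L(\mathcal{X}_n)/n^{(d-1)/d}\to\beta_L^d$ almost surely (known to exist). *)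

(* Defs.v *)
From HB Require Import structures.
From mathcomp Require Import all_boot all_order all_algebra finmap.
From mathcomp Require Import all_classical all_reals all_analysis.

Set Implicit Arguments.
Unset Strict Implicit.
Unset Printing Implicit Defensive.

Import Order.TTheory GRing.Theory Num.Theory.
Import numFieldNormedType.Exports.

Local Open Scope classical_set_scope.
Local Open Scope ring_scope.

(* Points of R^d are d-tuples: the tuple type carries the product sigma-algebra. *)
Notation Rpoint R d := (d.-tuple (measurableTypeR R)).

Definition eucl_dist (R : realType) (d : nat) (p q : Rpoint R d) : R :=
  Num.sqrt (\sum_(k < d) ((tnth p k : R) - (tnth q k : R)) ^+ 2).

Section Optimization.
Context {R : realType} (V : finType) (c : V -> V -> R).
Implicit Types (s : seq V) (S e : {set V}) (x : {set V} -> R).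

(* A tour is an enumeration of V, read cyclically. *)
Definition is_tour s : Prop := perm_eq s (enum V).

Definition tour_length s : R := \sum_(v <- s) c v (next s v).

(* Infimum of a nonempty finite set, hence a minimum. *)
Definition tsp_value : R := inf [set tour_length s | s in is_tour].

(* Edges {i, j} are the two-element subsets of V; the values of [x] on other
   subsets play no role. *)
Definition is_edge e : bool := #|e| == 2%N.

(* For c symmetric and e = {i, j} with i != j this is c i j
   (see [edge_cost_pair]). *)
Definition edge_cost e : R :=
  2^-1 * \sum_(i in e) \sum_(j in e | j != i) c i j.

Definition HK_feasible x : Prop :=
  [/\ forall i : V, \sum_(j : V | j != i) x [set i; j]%SET = 2,
      forall S, S != finset.set0 -> S \proper [set: V]%SET ->
        \sum_(e : {set V} | is_edge e && (e \subset S)) x e <= #|S|%:R - 1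
    & forall e, is_edge e -> 0 <= x e <= 1].

Definition HK_objective x : R :=
  \sum_(e : {set V} | is_edge e) edge_cost e * x e.

(* The program is feasible as soon as V has at least 3 elements; for smaller V
   the infimum is over the empty set, hence 0. *)
Definition hk_value : R := inf [set HK_objective x | x in HK_feasible].

Lemma edge_cost_pair (i j : V) :
  (forall u v, c u v = c v u) -> i != j -> edge_cost [set i; j]%SET = c i j.
Proof.
move=> csym ij.
have pairE (F : V -> R) : \sum_(k in [set i; j]%SET) F k = F i + F j.
  by rewrite big_setU1 ?inE// big_set1.
rewrite /edge_cost pairE !big_mkcondr !pairE !eqxx ij eq_sym ij /=.
by rewrite add0r addr0 (csym j i) -mulr2n -(mulr_natl (c i j)) mulrA mulVf
  ?mul1r// pnatr_eq0.
Qed.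

End Optimization.

Definition TSP (R : realType) (d : nat) (X : {fset Rpoint R d}) : R :=
  tsp_value (fun i j : X => eucl_dist (val i) (val j)).

Definition HK (R : realType) (d : nat) (X : {fset Rpoint R d}) : R :=
  hk_value (fun i j : X => eucl_dist (val i) (val j)).

Section RandomPoints.
Context {R : realType} (d : nat) {disp : measure_display}
  {T : measurableType disp} (P : probability T R).

(* The law of X is the d-fold product of the uniform law on [0, 1], i.e. the
   uniform law on [0, 1]^d; it is determined by its values on boxes. *)
Definition uniform_on_cube (X : {mfun T >-> Rpoint R d}) : Prop :=
  forall B : 'I_d -> set (measurableTypeR R), (forall k, measurable (B k)) ->
    distribution P X [set p | forall k, B k (tnth p k)]
    = (\prod_(k < d) uniform_prob (@ltr01 R) (B k))%E.

Definition mutually_independent (X : nat -> {mfun T >-> Rpoint R d}) : Prop :=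
  forall (J : {fset nat}) (A : nat -> set (Rpoint R d)),
    (forall i, measurable (A i)) ->
    P (\bigcap_(i in [set` J]) (X i @^-1` A i))
    = (\prod_(i <- J) P (X i @^-1` A i))%E.

Definition first_points (X : nat -> {mfun T >-> Rpoint R d}) (n : nat) (w : T) :
  {fset Rpoint R d} := [fset X (val i) w | i in 'I_n]%fset.

(* L(X_n) / n^((d-1)/d) --> beta almost surely. *)
Definition is_beta (L : {fset Rpoint R d} -> R)
    (X : nat -> {mfun T >-> Rpoint R d}) (beta : R) : Prop :=
  {ae P, forall w,
    (fun n : nat => L (first_points X n w) / n%:R `^ ((d%:R - 1) / d%:R))
      @ \oo --> beta}.

End RandomPoints.

(* Main.v *)
Require Import Defs.
From mathcomp Require Import all_boot all_order all_algebra finmap.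
From mathcomp Require Import all_classical all_reals all_analysis.
From mathcomp Require Import measurable_realfun.
From mathcomp Require Import zify ring lra.

(** Idea. There is a finite planar configuration, a lattice of triangles linked
    by paths, in which the shortest fractional tour beats every tour by much
    more than the diameter: discs around its points have disjoint interiors, a
    fractional tour (with weights 1/2 on the triangles) uses almost only
    tangent discs, and by parity a tour has to use a non-tangent pair near every
    triangle.

    Suppose that a rescaled copy B of it occurs in the sample next to a point v,
    far from all other points. By 2-optimality, a shortest tour enters B at most
    K + 1 times, where K depends only on d: two entering edges cannot come from
    nearly the same direction. Hence the tour can be separated into a tour of B
    and a tour of the rest at the cost of O(K diam B). Conversely a fractional
    tour of the rest and one of B can be merged at v at the cost of O(diam B).
    So every copy of B adds a fixed multiple of its diameter to TSP - HK.

    Cut the cube into g^d boxes and take n = m g^d sample points, with m the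
    number of points of a copy. The expected proportion of the boxes whose
    sample points form a copy is bounded below, each copy has diameter of order
    1/g, and n^((d-1)/d) is of order g^(d-1). By dominated convergence the
    proportion cannot tend to 0 almost surely, as it would if the two constants
    were equal. *)

Set Implicit Arguments.
Unset Strict Implicit.
Unset Printing Implicit Defensive.

Import Order.TTheory GRing.Theory Num.Theory.
Import numFieldNormedType.Exports.

Local Open Scope classical_set_scope.
Local Open Scope ring_scope.

(** * Fractional tours as weighted edge lists: splicing and insertion *)

Section WeightedEdges.
Context {R : realFieldType} {I : eqType}.
Implicit Types (V : seq I) (w x z : seq (I * I * R)) (h c : I -> I -> R) (U : pred I).

(** Cutting a cluster out of a tour and gluing it back loses a multiple of its diameter that depends
    on the dimension, while one gadget is only credited with half a unit. In an L by L lattice the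
    gain grows like L^2 and the loss like L, which is why the cluster is a large lattice and not one
    gadget. Twice the sum of the radii, 38 per gadget, is attained by a fractional tour up to O(L),
    whereas tours exceed it by L^2/2. Integer coordinates and radii turn tangency into an equality
    of natural numbers, decided by computation. A cluster cannot be spliced in at v like a tour,
    since a fractional tour may have no edge of weight 1 at v; half of the weight at v is
    transferred to the cluster instead. Gains add up because the clusters are treated one at a time:
    the tour of the remaining points is chosen shortest again at each stage, so that 2-optimality
    stays available. In the sample, a copy is described by one selected point in each of m blocks.
    For a given box at most one selection can occur, and all selections are equally likely, which
    makes the expected number of copies an explicit product. *)

Definition wsum w h : R := \sum_(e <- w) e.2 * h e.1.1 e.1.2.

Definition sep U (i j : I) : R := (U i != U j)%:R.

(* Subtour elimination in cut form, for a list of weighted edges. The degree of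
   a vertex is the value of the cut around it, so that loops do not count. *)
Definition fractional_tour V w : Prop :=
  [/\ forall e, e \in w -> [/\ e.1.1 \in V, e.1.2 \in V & 0 <= e.2],
      forall i, i \in V -> wsum w (sep (pred1 i)) = 2
    & forall U, has U V -> has (predC U) V -> 2 <= wsum w (sep U)].

Lemma wsum_nil h : wsum [::] h = 0.
Proof. by rewrite /wsum big_nil. Qed.

Lemma wsum_cons i j t w h : wsum ((i, j, t) :: w) h = t * h i j + wsum w h.
Proof. by rewrite /wsum big_cons. Qed.

Lemma wsum_cat w1 w2 h : wsum (w1 ++ w2) h = wsum w1 h + wsum w2 h.
Proof. by rewrite /wsum big_cat. Qed.

Lemma wsum_scaled a (s : I -> I) w h :
  wsum [seq (s e.1.1, s e.1.2, a * e.2) | e <- w] h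
  = a * wsum w (fun i j => h (s i) (s j)).
Proof.
by rewrite /wsum big_map mulr_sumr; apply: eq_bigr => e _; rewrite /= mulrA.
Qed.

Lemma eq_wsum V w h h' :
  (forall e, e \in w -> [/\ e.1.1 \in V, e.1.2 \in V & 0 <= e.2]) ->
  {in V &, h =2 h'} -> wsum w h = wsum w h'.
Proof.
move=> wV hh; rewrite /wsum; apply: eq_big_seq => e /wV[e1 e2 _].
by rewrite hh.
Qed.

Lemma wsum_eq0 V w h :
  (forall e, e \in w -> [/\ e.1.1 \in V, e.1.2 \in V & 0 <= e.2]) ->
  {in V &, forall i j, h i j = 0} -> wsum w h = 0.
Proof.
move=> wV hh; rewrite /wsum big_seq big1// => e /wV[e1 e2 _].
by rewrite hh// mulr0.
Qed.

Lemma wsum_ge0 V w h :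
  (forall e, e \in w -> [/\ e.1.1 \in V, e.1.2 \in V & 0 <= e.2]) ->
  (forall i j, 0 <= h i j) -> 0 <= wsum w h.
Proof.
move=> wV hh; rewrite /wsum big_seq sumr_ge0// => e /wV[_ _ e2].
by rewrite mulr_ge0.
Qed.

Lemma sep_ge0 U i j : 0 <= sep U i j. Proof. exact: ler0n. Qed.

Lemma sep_le1 U i j : sep U i j <= 1. Proof. by rewrite /sep lern1 leq_b1. Qed.

Lemma sep_sym U i j : sep U i j = sep U j i.
Proof. by rewrite /sep eq_sym. Qed.

Lemma sep_triangle U i j k : sep U i k <= sep U i j + sep U j k.
Proof.
rewrite -natrD ler_nat.
by case: (U i); case: (U j); case: (U k).
Qed.

Lemma sep_const V U : ~~ (has U V && has (predC U) V) ->
  {in V &, forall i j, U i = U j}.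
Proof.
rewrite negb_and -!all_predC => /orP[]/allP VU i j /VU/= + /VU/=.
  by move=> /negbTE-> /negbTE->.
by rewrite !negbK => -> ->.
Qed.

Lemma has_sepP V U i j : i \in V -> j \in V -> U i != U j ->
  has U V && has (predC U) V.
Proof.
move=> iV jV Uij; apply/andP; split; apply/hasP.
  by case Ui: (U i) Uij; [exists i | case Uj: (U j) => // _; exists j].
case Ui: (U i) Uij; last by exists i => //=; rewrite Ui.
by case Uj: (U j) => // _; exists j => //=; rewrite Uj.
Qed.

Lemma fractional_tour_perm V V' w : V =i V' ->
  fractional_tour V w -> fractional_tour V' w.
Proof.
move=> VV [wV deg cut]; split=> [e /wV|i|U].
- by rewrite !VV.
- by rewrite -VV; exact: deg.
- by rewrite -!(eq_has_r VV); exact: cut.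
Qed.

(* Two fractional tours are spliced along edges of weight 1, as two tours
   are. *)
Lemma fractional_tour_splice V1 V2 v b p q x z :
  {in V1, forall i, i \notin V2} -> v != b -> p != q ->
  fractional_tour V1 ((v, b, 1) :: x) -> fractional_tour V2 ((p, q, 1) :: z) ->
  fractional_tour (V1 ++ V2) [:: (p, b, 1), (v, q, 1) & x ++ z].
Proof.
move=> dV vb pq [xV degx cutx] [zV degz cutz].
have [/= vV bV _] := xV _ (mem_head _ _).
have [/= pV qV _] := zV _ (mem_head _ _).
have xV' e (ex : e \in x) := xV e (mem_behead (s := _ :: _) ex).
have zV' e (ez : e \in z) := zV e (mem_behead (s := _ :: _) ez).
have dV' i : i \in V1 -> i \in V2 -> False.
  by move=> /dV/negP.
have dVn i j : i \in V1 -> j \in V2 -> (i == j) = false.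
  by move=> i1 j2; apply/eqP => e; apply: (dV' i); rewrite // e.
have dVn' i j : i \in V1 -> j \in V2 -> (j == i) = false.
  by move=> i1 j2; rewrite eq_sym dVn.
split.
- move=> e; rewrite !inE mem_cat !mem_cat => /or3P[/eqP->|/eqP->|/orP[/xV'|/zV']] /=.
  + by rewrite pV bV orbT ler01.
  + by rewrite vV qV orbT ler01.
  + by case=> -> ->.
  + by case=> -> -> ->; rewrite !orbT.
- move=> i; rewrite !wsum_cons wsum_cat mem_cat !mul1r => /orP[i1|i2].
  + have := degx _ i1; rewrite wsum_cons mul1r.
    rewrite (@wsum_eq0 _ z (sep _) zV'); last first.
      by move=> j k j2 k2; rewrite /sep /= !dVn'.
    rewrite /sep /= (dVn' i q) // (dVn' i p) //.
    have [evi|vi] := eqVneq v i; last by case: (b == i) => /=; lra.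
    by rewrite -evi [b == v]eq_sym (negbTE vb) /=; lra.
  + have := degz _ i2; rewrite wsum_cons mul1r.
    rewrite (@wsum_eq0 _ x (sep _) xV'); last first.
      by move=> j k j2 k2; rewrite /sep /= !dVn.
    rewrite /sep /= (dVn v i) // (dVn b i) //.
    have [epi|pi] := eqVneq p i; last by case: (q == i) => /=; lra.
    by rewrite -epi [q == p]eq_sym (negbTE pq) /=; lra.
- move=> U; rewrite !has_cat !wsum_cons wsum_cat !mul1r => UV UcV.
  have x0 : 0 <= wsum x (sep U) by apply: wsum_ge0 xV' _ => *; exact: sep_ge0.
  have z0 : 0 <= wsum z (sep U) by apply: wsum_ge0 zV' _ => *; exact: sep_ge0.
  (* If U cuts both parts, the cuts total at least 4 and the two removed edges account for at most
     2. If it cuts only one part, the other part acts as a single point through which the removed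
     edge is rerouted. If it cuts neither, both new edges cross. *)
  case: (boolP (has U V1 && has (predC U) V1)) => U1;
  case: (boolP (has U V2 && has (predC U) V2)) => U2.
  + have /andP[/cutx/[apply]] := U1; have /andP[/cutz/[apply]] := U2.
    rewrite !wsum_cons !mul1r.
    have := sep_le1 U v b; have := sep_le1 U p q.
    have := sep_ge0 U p b; have := sep_ge0 U v q; lra.
  + have /andP[/cutx/[apply]] := U1; rewrite !wsum_cons !mul1r.
    have pqE : sep U p b = sep U q b by rewrite /sep (sep_const U2 pV qV).
    have := sep_triangle U v q b; lra.
  + have /andP[/cutz/[apply]] := U2; rewrite !wsum_cons !mul1r.
    have vbE : sep U v q = sep U b q by rewrite /sep (sep_const U1 vV bV).
    have := sep_triangle U p b q; lra.
  + have c1 := sep_const U1; have c2 := sep_const U2.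
    have Uvp : U v != U p.
      apply/negP => /eqP Uvp.
      have UE i : i \in V1 ++ V2 -> U i = U v.
        by rewrite mem_cat => /orP[i1|i2]; [exact: c1 | rewrite (c2 i p)].
      move: UV UcV; rewrite -!has_cat => /hasP[i /UE-> Uv] /hasP[j /UE/= ->].
      by rewrite Uv.
    rewrite /sep -(c1 _ _ vV bV) -(c2 _ _ pV qV) Uvp eq_sym Uvp.
    by move: x0 z0; rewrite /=; lra.
Qed.

Definition redirect (v p i : I) : I := if i == v then p else i.

Definition split_edges (v p : I) x : seq (I * I * R) :=
  [seq (e.1.1, e.1.2, 2^-1 * e.2) | e <- x] ++
  [seq (redirect v p e.1.1, redirect v p e.1.2, 2^-1 * e.2) | e <- x].

Lemma wsum_split v p x h :
  wsum (split_edges v p x) h =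
  2^-1 * wsum x h
  + 2^-1 * wsum x (fun i j => h (redirect v p i) (redirect v p j)).
Proof.
by rewrite wsum_cat (wsum_scaled _ (redirect v p)) (wsum_scaled _ id).
Qed.

(* Half of every edge at v is moved to p; the vertices v and p then each have
   one unit of degree left, which is used to route through the tour on V2. *)
Lemma fractional_tour_insert V1 V2 v y p q x z :
  {in V1, forall i, i \notin V2} -> v \in V1 -> y \in V1 -> y != v -> p != q ->
  fractional_tour V1 x -> fractional_tour V2 ((p, q, 1) :: z) ->
  fractional_tour (V1 ++ V2) ((v, q, 1) :: split_edges v p x ++ z).
Proof.
move=> dV vV yV yv pq [xV degx cutx] [zV degz cutz].
have [/= pV qV _] := zV _ (mem_head _ _).
have zV' e (ez : e \in z) := zV e (mem_behead (s := _ :: _) ez).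
have dV' i : i \in V1 -> i \in V2 -> False.
  by move=> /dV/negP.
have dVn i j : i \in V1 -> j \in V2 -> (i == j) = false.
  by move=> i1 j2; apply/eqP => e; apply: (dV' i); rewrite // e.
have dVn' i j : i \in V1 -> j \in V2 -> (j == i) = false.
  by move=> i1 j2; rewrite eq_sym dVn.
split.
- move=> e; rewrite inE !mem_cat => /or3P[/eqP->|/orP[]/mapP[e' /xV[e1 e2 e3]->]|/zV'] /=.
  + by rewrite vV qV orbT ler01.
  + by rewrite e1 e2; split=> //; rewrite mulr_ge0// invr_ge0.
  + rewrite /redirect; split; last by rewrite mulr_ge0// invr_ge0.
      by case: ifP; rewrite ?pV ?e1 ?orbT.
    by case: ifP; rewrite ?pV ?e2 ?orbT.
  + by case=> -> ->; rewrite !orbT.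
- move=> i; rewrite !wsum_cons wsum_cat wsum_split mem_cat !mul1r => /orP[i1|i2].
  + rewrite (@wsum_eq0 _ z (sep _) zV'); last first.
      by move=> j k j2 k2; rewrite /sep /= !dVn'.
    rewrite degx // [sep _ v q]/sep /= (dVn' i q) //.
    have [evi|vi] := eqVneq v i.
      rewrite (@wsum_eq0 _ x _ xV) => [/=|j k j2 k2]; first by lra.
      rewrite /sep /redirect /= -evi.
      by case: (eqVneq j v) => [_|/negbTE->]; case: (eqVneq k v) => [_|/negbTE->];
        rewrite ?(dVn' v p) ?eqxx.
    rewrite [wsum x _](_ : _ = 2) /=; first by lra.
    rewrite -(degx i i1); apply: (eq_wsum xV) => j k j2 k2.
    rewrite /sep /redirect /=.
    by case: (eqVneq j v) => [->|_]; case: (eqVneq k v) => [->|_];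
        rewrite ?(dVn' i p) ?eqxx // (negbTE vi).
  + have := degz _ i2; rewrite wsum_cons mul1r.
    rewrite (@wsum_eq0 _ x (sep _) xV); last first.
      by move=> j k j2 k2; rewrite /sep /= !dVn.
    have -> : wsum x (fun i0 j => sep (pred1 i) (redirect v p i0) (redirect v p j))
       = (p == i)%:R * 2.
      have [<-|pi] := eqVneq p i.
        rewrite mul1r -(degx v vV); apply: (eq_wsum xV) => j k jV kV.
        rewrite /sep /redirect /=; case: (eqVneq j v) => [_|_]; case: (eqVneq k v) => [_|_];
        by rewrite ?eqxx ?(dVn _ p) //.
      rewrite mul0r; apply: (wsum_eq0 xV) => j k jV kV; rewrite /sep /redirect /=.
      by case: (eqVneq j v) => [_|_]; case: (eqVneq k v) => [_|_];
        rewrite ?(negbTE pi) ?eqxx ?dVn.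
    rewrite /sep /= (dVn v i) //.
    have [epi|] := eqVneq p i; have [eqi|] := eqVneq q i;
       rewrite ?epi ?eqi ?eqxx in pq * => //=; lra.
- move=> U; rewrite !has_cat !wsum_cons wsum_cat wsum_split !mul1r => UV UcV.
  have x0 : 0 <= wsum x (sep U) by apply: wsum_ge0 xV _ => *; exact: sep_ge0.
  set X2 := wsum x (fun i j => sep U (redirect v p i) (redirect v p j)).
  have x20 : 0 <= X2 by apply: wsum_ge0 xV _ => *; exact: sep_ge0.
  have z0 : 0 <= wsum z (sep U) by apply: wsum_ge0 zV' _ => *; exact: sep_ge0.
  have cut2 : has U V2 && has (predC U) V2 -> 2 <= sep U p q + wsum z (sep U).
    by case/andP => /cutz/[apply]; rewrite wsum_cons mul1r.
  (* When v and p lie on the same side, redirection does not change the cut and the two halves add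
     up to the cut of [x]. *)
  have [Uvp|Uvp] := boolP (U v == U p).
    have -> : X2 = wsum x (sep U).
      apply: (eq_wsum xV) => j k _ _; rewrite /sep /redirect.
      by case: (eqVneq j v) => [->|_]; case: (eqVneq k v) => [->|_];
        rewrite ?(eqP Uvp).
    case: (boolP (has U V1 && has (predC U) V1)) => U1.
      have /andP[/cutx/[apply]] := U1; have := sep_ge0 U v q; lra.
    case: (boolP (has U V2 && has (predC U) V2)) => U2.
      have := cut2 U2; rewrite /sep (eqP Uvp); lra.
    exfalso; have c1 := sep_const U1; have c2 := sep_const U2.
    have UE i : i \in V1 ++ V2 -> U i = U v.
      by rewrite mem_cat => /orP[i1|i2]; [exact: c1 | rewrite (c2 i p) ?(eqP Uvp)].
    by move: UV UcV; rewrite -!has_cat => /hasP[i /UE-> Uv] /hasP[j /UE/= ->]; rewrite Uv.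
  (* As v and p are on different sides, y is separated from one of them: either the original or the
     redirected half of [x] has a full cut. This gives 1; the other 1 comes from the edge from v to
     q or from [z]. *)
  have X1 : 2 <= wsum x (sep U) + X2.
    have [Uvy|Uvy] := boolP (U v == U y); last first.
      have /andP[/cutx/[apply]] := has_sepP vV yV Uvy; lra.
    have [|U1 U2] := andP (@has_sepP V1 (U \o redirect v p) v y vV yV _).
      by rewrite /redirect /= eqxx (negbTE yv) -(eqP Uvy) eq_sym.
    have : 2 <= X2 by exact: cutx U1 U2.
    lra.
  have : 1 <= sep U v q + wsum z (sep U); last by lra.
  have [Uvq|Uvq] := boolP (U v == U q); last first.
    by rewrite /sep Uvq /=; lra.
  have Upq : U p != U q by rewrite -(eqP Uvq) eq_sym.
  have := cut2 (has_sepP pV qV Upq).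
  by rewrite /sep Upq Uvq /=; lra.
Qed.

(** Moving an end from v to p costs at most [c v p] per unit of weight, and the weight moved is half
    of the degree 2. *)
Lemma wsum_split_le V v p x c : fractional_tour V x ->
  v \in V -> (forall i, c i i = 0) -> (forall i j, c i j = c j i) ->
  (forall i j k, c i k <= c i j + c j k) ->
  wsum (split_edges v p x) c <= wsum x c + c v p.
Proof.
move=> [xV degx _] vV c0 cC ctri; rewrite wsum_split.
suff : wsum x (fun i j => c (redirect v p i) (redirect v p j))
    <= wsum x c + c v p * wsum x (sep (pred1 v)).
  by rewrite degx//; lra.
rewrite /wsum mulr_sumr -big_split big_seq [leRHS]big_seq /=.
apply: ler_sum => e /xV[_ _ e0].
rewrite mulrCA -mulrDr ler_wpM2l// /redirect /sep /=.
have := ctri p v e.1.2; have := ctri e.1.1 v p; rewrite (cC p v).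
case: (eqVneq e.1.1 v) => [->|_]; case: (eqVneq e.1.2 v) => [->|_]; rewrite ?c0 /=; lra.
Qed.

End WeightedEdges.

Lemma fractional_tour_map {R : realFieldType} {I J : eqType} (f : I -> J)
    (V : seq I) (w : seq (I * I * R)) :
  {in V &, injective f} -> fractional_tour V w ->
  fractional_tour (map f V) [seq (f e.1.1, f e.1.2, e.2) | e <- w].
Proof.
move=> fI [wV degw cutw].
have wsumE h : wsum [seq (f e.1.1, f e.1.2, e.2) | e <- w] h =
               wsum w (fun i j => h (f i) (f j)) by rewrite /wsum big_map.
split.
- by move=> _ /mapP[e /wV[e1 e2 e3] ->]; split; rewrite /= ?map_f.
- move=> _ /mapP[i iV ->]; rewrite wsumE -(degw i iV).
  apply: (eq_wsum wV) => j k jV kV; rewrite /sep /=.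
  by rewrite !(inj_in_eq fI).
- by move=> U; rewrite !has_map => U1 U2; rewrite wsumE; exact: cutw U1 U2.
Qed.

(** * Shortest closed tours, 2-optimality and separation of a cluster *)

Section ClosedTours.
Context {R : realFieldType} {I : eqType}.
Implicit Types (c F : I -> I -> R) (s t p q : seq I) (x y z : I).

Fixpoint path_length c x p : R :=
  if p is y :: p' then c x y + path_length c y p' else 0.

Definition closed_length c s : R :=
  if s is x :: p then path_length c x (rcons p x) else 0.

Definition optimal_tour c s : Prop :=
  forall t, perm_eq t s -> closed_length c s <= closed_length c t.

Lemma path_length_cat c x p q :
  path_length c x (p ++ q) = path_length c x p + path_length c (last x p) q.
Proof. by elim: p x => [|y p IH] x /=; rewrite ?add0r// IH addrA. Qed.

Lemma path_length_rcons c x p y :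
  path_length c x (rcons p y) = path_length c x p + c (last x p) y.
Proof. by rewrite -cats1 path_length_cat /= addr0. Qed.

Lemma path_lengthD c F x p :
  path_length (fun i j => c i j + F i j) x p = path_length c x p + path_length F x p.
Proof. by elim: p x => [|y p IH] x /=; rewrite ?addr0// IH addrACA. Qed.

Lemma path_lengthMr F a x p :
  path_length (fun i j => F i j * a) x p = path_length F x p * a.
Proof. by elim: p x => [|y p IH] x /=; rewrite ?mul0r// IH mulrDl. Qed.

Lemma path_length_rev c x p : (forall i j, c i j = c j i) ->
  path_length c (last x p) (rev (belast x p)) = path_length c x p.
Proof.
move=> cC; elim: p x => [|y p IH] x //=.
rewrite rev_cons path_length_rcons IH addrC cC; congr (c _ _ + _).
by case: p {IH} => //= z p; rewrite rev_cons last_rcons.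
Qed.

Lemma closed_length_catC c s t : closed_length c (s ++ t) = closed_length c (t ++ s).
Proof.
case: s t => [|x p] [|y q]; rewrite ?cats0//=.
rewrite -!cats1 -!catA /= !path_length_cat /= !path_length_cat /=; ring.
Qed.

Lemma closed_length_rot c n s : closed_length c (rot n s) = closed_length c s.
Proof. by rewrite /rot closed_length_catC cat_take_drop. Qed.

Lemma sum_next F s : uniq s ->
  \sum_(v <- s) F v (next s v) = closed_length F s.
Proof.
case: s => [|y0 p]; first by rewrite big_nil.
rewrite /closed_length /next; move: {1 2 4 5}y0 => x.
elim: p x => [|y p IH] x /=; first by rewrite big_seq1 eqxx addr0.
move=> /andP[xp up]; rewrite big_cons eqxx; congr (_ + _).
rewrite -IH//; apply: eq_big_seq => v vp.
by case: eqP => // e; rewrite -e vp in xp.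
Qed.

Lemma ex_optimal_tour c s : exists2 t, perm_eq t s & optimal_tour c t.
Proof.
have ex_min (l : seq (seq I)) : l != [::] -> exists2 t, t \in l &
    {in l, forall u, closed_length c t <= closed_length c u}.
  elim: l => // a l IH _; have [->|/IH[t tl tmin]] := eqVneq l [::].
    by exists a; rewrite ?mem_head// => u; rewrite inE => /eqP->.
  have [at_|/ltW ta] := leP (closed_length c a) (closed_length c t).
    exists a; first exact: mem_head.
    by move=> u; rewrite inE => /predU1P[->//|/tmin]; exact: le_trans.
  exists t; first by rewrite inE tl orbT.
  by move=> u; rewrite inE => /predU1P[->//|/tmin].
have ne : permutations s != [::].
  by apply/eqP => e; have := mem_permutations s s; rewrite e perm_refl.
have [t] := ex_min _ ne; rewrite mem_permutations => ts tmin; exists t => // u ut; apply: tmin.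
by rewrite mem_permutations (perm_trans ut).
Qed.

Lemma optimal_tour_rot c n s : optimal_tour c s -> optimal_tour c (rot n s).
Proof.
move=> opt t; rewrite closed_length_rot => ts; apply: opt.
by rewrite (perm_trans ts)// perm_rot.
Qed.

Lemma next_head x p : next (x :: p) x = head x p.
Proof. by case: p => [|y p] /=; rewrite eqxx. Qed.

(* Otherwise the two edges could be exchanged, reversing the path between
   them. *)
Lemma optimal_tour_2opt c s x y : (forall i j, c i j = c j i) ->
  uniq s -> optimal_tour c s -> x \in s -> y \in s -> x != y ->
  c x (next s x) + c y (next s y) <= c x y + c (next s x) (next s y).
Proof.
move=> cC us opt xs ys xy.
have [i s' rs] := rot_to xs.
have us' : uniq (x :: s') by rewrite -rs rot_uniq.
have : y \in x :: s' by rewrite -rs mem_rot.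
rewrite inE eq_sym (negbTE xy)/= => ys'.
rewrite -!(next_rot i us) rs.
move: opt => /(optimal_tour_rot (n := i)); rewrite rs {rs i xs ys us} => opt.
case/splitPr: ys' us' opt => p1 p2 us' opt.
have -> : next (x :: p1 ++ y :: p2) y = head x (rcons p2 x).
  rewrite -(next_rot (size (x :: p1)) us') -cat_cons rot_size_cat next_head.
  by case: (p2).
rewrite next_head.
have -> : head x (p1 ++ y :: p2) = head x (rcons p1 y) by case: (p1).
have := opt (x :: rev (rcons p1 y) ++ p2); rewrite perm_cons.
have -> : perm_eq (rev (rcons p1 y) ++ p2) (p1 ++ y :: p2).
  by rewrite -cat_rcons perm_cat2r perm_rev.
move=> /(_ isT); rewrite /= -cat_rcons !rcons_cat !path_length_cat.
rewrite last_rcons.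
case: (rcons p1 y) (last_rcons x p1 y) => [/= e|b q /= <-].
  by rewrite e eqxx in xy.
case E : (rcons p2 x) => [|b' q2] /=; first by case: (p2) E.
rewrite -[rev (b :: q)](_ : last b q :: rev (belast b q) = _); last first.
  by rewrite [in RHS]lastI rev_rcons.
rewrite /= path_length_rev//.
have -> : last (last b q) (rev (belast b q)) = b.
  by case: (q) => //= z q'; rewrite rev_cons last_rcons.
lra.
Qed.

Section Filter.
Context (c : I -> I -> R) (B : pred I) (r : R).
Context (c_ge0 : forall i j, 0 <= c i j).
Context (c_triangle : forall i j k, c i k <= c i j + c j k).
Context (c_diam : forall i j, B i -> B j -> c i j <= r).

Let cE i j := c i j + (~~ B i && B j)%:R * (2 * r).

(** Both walks are followed at once. In the first invariant the tour is at x outside B and z is the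
    last point seen in B. In the second it is at y in B, x is the last point seen outside and e is
    where B was entered; [c x e + r] pays for the later shortcut from x past B. The charge 2r of
    [cE] at an entry covers the jump from z to the new run and the r of that shortcut. *)
Let filter_path p :
  (forall x z, ~~ B x -> B z ->
    path_length c x (seq.filter (predC B) p) + path_length c z (seq.filter B p)
    <= path_length cE x p) /\
  (forall x e y, ~~ B x -> B e -> B y ->
    path_length c x (seq.filter (predC B) p) + path_length c y (seq.filter B p)
    <= path_length cE y p + c x e + r).
Proof.
elim: p => [|w p [IHA IHB]]; split.
- by move=> x z _ _ /=; rewrite addr0.
- move=> x e y _ Be By /=; have := c_diam Be By.
  by have := c_ge0 x e; have := c_ge0 e y; lra.
- move=> x z Bx Bz /=; rewrite /cE Bx; case: ifP => Bw /=; rewrite ?Bw /=.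
    by have := IHA w z; rewrite Bw => /(_ isT Bz); rewrite (negbTE Bw) /=; lra.
  have {}Bw : B w by apply: negbFE.
  have := IHB x w w Bx Bw Bw; have := c_diam Bz Bw; rewrite Bw /=; lra.
- move=> x e y Bx Be By /=; rewrite /cE By; case: ifP => Bw /=.
    have := IHA w y Bw By; have := c_triangle x e w; have := c_triangle e y w.
    have := c_diam Be By; rewrite (negbTE Bw) /=; lra.
  have {}Bw : B w by apply: negbFE.
  have := IHB x e w Bx Be Bw; rewrite Bw /=; lra.
Qed.

(* Each maximal run of B-vertices in the tour is bypassed by one edge, and
   consecutive runs are joined into a tour of B: both cost at most r on top of
   the existing edges. *)
Lemma tour_separate s : uniq s -> has (predC B) s -> has B s ->
  exists sA sB, [/\ perm_eq sA (seq.filter (predC B) s), perm_eq sB (seq.filter B s) &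
    closed_length c sA + closed_length c sB <= closed_length c s
      + 2 * r * \sum_(v <- s) (~~ B v && B (next s v))%:R].
Proof.
move=> us /hasP[x xs /= Bx] sB.
rewrite (sum_next (fun i j => (~~ B i && B j)%:R) us).
have [i p rs] := rot_to xs.
have us' : uniq (x :: p) by rewrite -rs rot_uniq.
exists (seq.filter (predC B) (x :: p)), (seq.filter B (x :: p)); split.
- by rewrite -rs perm_filter// perm_rot.
- by rewrite -rs perm_filter// perm_rot.
rewrite -2!(closed_length_rot _ i s) rs.
have -> : closed_length c (x :: p) +
    2 * r * closed_length (fun i0 j => (~~ B i0 && B j)%:R) (x :: p)
    = path_length cE x (rcons p x).
  by rewrite /= path_lengthD path_lengthMr mulrC.
rewrite /= Bx (negbTE Bx) /=.
have -> : rcons (seq.filter (predC B) p) x = seq.filter (predC B) (rcons p x).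
  by rewrite filter_rcons /= Bx.
have : seq.filter B (rcons p x) = seq.filter B p by rewrite filter_rcons (negbTE Bx).
case E : (seq.filter B p) => [|y q] EB /=.
  exfalso; move: sB; rewrite -(has_rot i) rs /= (negbTE Bx) has_filter E.
  by [].
have Bl : B (last y q).
  have : last y q \in seq.filter B p by rewrite E mem_last.
  by rewrite mem_filter => /andP[].
(* Starting the B-walk at the last B-vertex of the tour makes it a closed walk. *)
have [/(_ _ _ Bx Bl) + _] := filter_path (rcons p x).
by rewrite EB /= !path_length_rcons; lra.
Qed.
End Filter.

End ClosedTours.

Lemma closed_length_map {R : realFieldType} {I J : eqType} (f : I -> J)
    (c : J -> J -> R) (s : seq I) :
  closed_length c (map f s) = closed_length (fun i j => c (f i) (f j)) s.
Proof.
case: s => //= x p; rewrite -map_rcons.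
by elim: (rcons p x) {1 3}x => //= y q IH x'; rewrite IH.
Qed.

Section TourEdges.
Context {R : realFieldType} {I : eqType}.
Implicit Types (c : I -> I -> R) (s : seq I).

Definition tour_edges s : seq (I * I * R) := [seq (i, next s i, 1) | i <- s].

Lemma wsum_tour_edges s c : uniq s -> wsum (tour_edges s) c = closed_length c s.
Proof.
move=> us; rewrite -sum_next// /wsum big_map.
by apply: eq_bigr => i _; rewrite mul1r.
Qed.

Lemma path_length_ge c x p :
  (forall i, c i i = 0) -> (forall i j k, c i k <= c i j + c j k) ->
  c x (last x p) <= path_length c x p.
Proof.
move=> c0 ct; elim: p x => [|y p IH] x /=; first by rewrite c0.
by have := ct x y (last y p); have := IH y; lra.
Qed.

Lemma sepxx (U : pred I) i : sep U i i = 0 :> R.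
Proof. by rewrite /sep eqxx. Qed.

(** [sep U] satisfies the triangle inequality, so each of the two arcs between a vertex in U and one
    outside has [sep U]-length at least 1. *)
Lemma tour_fractional s : uniq s -> (1 < size s)%N ->
  fractional_tour s (tour_edges s).
Proof.
move=> us s2; split.
- move=> _ /mapP[i si ->] /=.
  by rewrite si mem_next si ler01.
- move=> i si; rewrite wsum_tour_edges//.
  have [k s' rs] := rot_to si; rewrite -(closed_length_rot _ k) rs.
  move: us s2; rewrite -(rot_uniq k) -(size_rot k) rs.
  case: s' {rs} => //= y p /andP[iyp _] _.
  rewrite path_length_rcons.
  have -> : path_length (sep (pred1 i)) y p = 0 :> R.
    elim: p y iyp => [|z p IH] y //=; rewrite !inE !negb_or => /and3P[iy iz ip].
    rewrite IH ?inE ?negb_or ?iz// addr0 /sep /=.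
    by rewrite (eq_sym y) (eq_sym z) (negbTE iy) (negbTE iz).
  have li : last y p == i = false.
    by apply/eqP => e; move: iyp; rewrite -e mem_last.
  have yi : y == i = false.
    by apply/eqP => e; move: iyp; rewrite -e mem_head.
  by rewrite /sep /= eqxx yi li /= add0r.
- move=> U /hasP[x xs Ux] /hasP[y ys /= Uy]; rewrite wsum_tour_edges//.
  have [k s' rs] := rot_to xs; rewrite -(closed_length_rot _ k) rs.
  have : y \in s'.
    have : y \in rot k s by rewrite mem_rot.
    by rewrite rs inE => /predU1P[e|//]; rewrite e Ux in Uy.
  case/splitPr => p q /=; rewrite rcons_cat path_length_cat /=.
  have sepge := path_length_ge _ _ (@sepxx U) (@sep_triangle _ _ U).
  have := sepge y (rcons q x); have := sepge x (rcons p y).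
  rewrite !last_rcons path_length_rcons (sep_sym U y) /sep Ux (negbTE Uy) /=.
  lra.
Qed.

End TourEdges.

(** * Clusters and the additivity of the gap *)

Section ClusterReduction.
Context {R : realFieldType} {I : eqType} (c : I -> I -> R).
Context (c_ge0 : forall i j, 0 <= c i j) (c_diag : forall i, c i i = 0)
  (c_sym : forall i j, c i j = c j i)
  (c_triangle : forall i j k, c i k <= c i j + c j k).

Definition fractional_le (V : seq I) (t : R) : Prop :=
  exists2 w, fractional_tour V w & wsum w c <= t.

(* Adding the cluster B next to v widens the gap between the lengths of
   integral and fractional tours by at least g, whatever the other points of X
   that are kept. *)
Definition gap_cluster (X : seq I) (v : I) (B : seq I) (g : R) : Prop :=
  forall V s d, {subset V <= X} -> v \in V -> has (predC1 v) V ->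
    uniq (V ++ B) -> perm_eq s (V ++ B) -> optimal_tour c s ->
    (forall t, perm_eq t V -> optimal_tour c t ->
       fractional_le V (closed_length c t - d)) ->
    fractional_le (V ++ B) (closed_length c s - d - g).

(** Induction on the clusters, with [d] in [gap_cluster] taken as the gap due to the remaining ones.
    Without clusters, a shortest tour is its own fractional tour. The two points of A ensure that
    the point v of a cluster always has a companion. *)
Lemma gap_clusters (g : R) (X A : seq I) (cl : seq (I * seq I)) (s : seq I) :
  {subset A ++ flatten (unzip2 cl) <= X} ->
  uniq (A ++ flatten (unzip2 cl)) -> (1 < size A)%N ->
  (forall b, b \in cl -> b.1 \in A /\ gap_cluster X b.1 b.2 g) ->
  perm_eq s (A ++ flatten (unzip2 cl)) -> optimal_tour c s ->
  fractional_le (A ++ flatten (unzip2 cl)) (closed_length c s - g *+ size cl).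
Proof.
move=> + + A2; elim: cl s => [|[v B] cl IH] s subX uX ok ps opt.
  rewrite /= cats0 in ps uX *.
  have us : uniq s by rewrite (perm_uniq ps).
  exists (tour_edges s); last by rewrite wsum_tour_edges// mulr0n subr0.
  apply: fractional_tour_perm (perm_mem ps) _; apply: tour_fractional => //.
  by rewrite (perm_size ps).
have [/= vA gB] := ok _ (mem_head _ _).
set V := A ++ flatten (unzip2 cl).
have pE : perm_eq (A ++ flatten (unzip2 ((v, B) :: cl))) (V ++ B).
  by rewrite /= -catA perm_cat2l perm_catC.
have uV : uniq (V ++ B) by rewrite -(perm_uniq pE).
have [||||t pt ot|w fw cw] := gB V s (g *+ size cl) _ _ _ uV _ opt.
- by move=> i iV; apply: subX; rewrite (perm_mem pE) mem_cat iV.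
- by rewrite mem_cat vA.
- move: uV; rewrite cat_uniq => /andP[]; rewrite cat_uniq => /andP[uA _] _.
  rewrite /V has_cat; apply/orP; left.
  case: (A) A2 uA => [|x [|y A']] //= _.
  case/and3P => + _ _; rewrite inE negb_or => /andP[xy _].
  by have [<-|] //= := eqVneq x v; rewrite eq_sym xy.
- by rewrite (perm_trans ps).
- apply: IH => //.
  + by move=> i iV; apply: subX; rewrite (perm_mem pE) mem_cat iV.
  + by move: uV; rewrite cat_uniq => /andP[].
  + by move=> b bcl; apply: ok; rewrite inE bcl orbT.
exists w; last by rewrite mulrS opprD addrA addrAC.
by apply: fractional_tour_perm fw => i; rewrite (perm_mem pE).
Qed.

(* [o] is a reference point of B; two points of the same cell are seen from [o]
   in nearly the same direction, so that a shortest tour cannot enter B from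
   both. *)
Lemma few_entries (T : finType) (cell : I -> T) (s B : seq I) (v o : I) (r : R) :
  uniq s -> optimal_tour c s -> o \in B -> {in B &, forall i j, c i j <= r} ->
  {in s &, forall i j, i \notin B -> j \notin B -> i != v -> j != v -> i != j ->
     cell i = cell j -> c i j + 3 * r < c i o + c j o} ->
  \sum_(i <- s) ((i \notin B) && (next s i \in B))%:R <= #|T|.+1%:R :> R.
Proof.
move=> us opt oB diam far.
rewrite -natr_sum ler_nat.
pose E := [seq i <- s | (i \notin B) && (next s i \in B) & i != v].
have le1 : (\sum_(i <- s) ((i \notin B) && (next s i \in B)) <= size E + count (pred1 v) s)%N.
  rewrite size_filter -!sum1_count [in leqRHS]big_mkcond [X in (_ <= _ + X)%N]big_mkcond.
  rewrite -big_split; apply: leq_sum => i _ /=.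
  by case: (_ && _); case: (i == v).
(* The hypothesis on cells says nothing about v, which may give one more entry. *)
apply: leq_trans le1 _; rewrite -addn1 leq_add//; last first.
  by rewrite count_uniq_mem// leq_b1.
(* For entries from i and j in one cell, 2-optimality gives [c i (next s i) + c j (next s j) <= c i
   j + r]. Replacing each end in B by [o] costs r, so [c i o + c j o <= c i j + 3 * r], against the
   hypothesis. *)
have inj : {in E &, injective cell}.
  move=> i j; rewrite !mem_filter => /andP[/andP[/andP[iB niB] iv] si].
  move=> /andP[/andP[/andP[jB njB] jv] sj] cij.
  apply/eqP/negPn/negP => ij.
  have := far _ _ si sj iB jB iv jv ij cij.
  have := optimal_tour_2opt c_sym us opt si sj ij.
  have := diam _ _ niB njB; have := diam _ _ niB oB; have := diam _ _ njB oB.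
  have := c_triangle i (next s i) o; have := c_triangle j (next s j) o; lra.
have uE : uniq (map cell E) by rewrite map_inj_in_uniq// filter_uniq.
by rewrite -(size_map cell) -(card_uniqP uE) max_card.
Qed.

(** The tour splits into a tour of V and one of B, of length at least l, at the price of 2r per
    entry. On the fractional side, insertion at v costs [c v p + c v q], while the edge from p to q
    is saved: only [z] is paid for. *)
Lemma gap_clusterI (T : finType) (cell : I -> T) (X : seq I) (v : I) (B : seq I)
    (p q : I) (z : seq (I * I * R)) (r l : R) :
  {in B &, forall i j, c i j <= r} ->
  {in X &, forall i j, i \notin B -> j \notin B -> i != v -> j != v -> i != j ->
     cell i = cell j -> c i j + 3 * r < c i p + c j p} ->
  p != q -> fractional_tour B ((p, q, 1) :: z) ->
  (forall t, perm_eq t B -> l <= closed_length c t) ->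
  gap_cluster X v B
    (l - wsum z c - c v p - c v q - 2 * #|T|.+1%:R * r).
Proof.
move=> diam far pq fB lB V s d VX vV /hasP[y yV /= yv] uVB ps opt IH.
have us : uniq s by rewrite (perm_uniq ps).
have [/= pB qB _] : [/\ (p, q, 1 : R).1.1 \in B, (p, q, 1 : R).1.2 \in B &
    0 <= (p, q, 1 : R).2] by case: fB => + _ _; apply; exact: mem_head.
have VB : {in V, forall i, i \notin B}.
  move=> i iV; move: uVB; rewrite cat_uniq => /and3P[_ /hasPn VB _].
  by apply/negP => /VB; rewrite /= iV.
have [sA [sB [pA pB' le]]] : exists sA sB, [/\ perm_eq sA (seq.filter (predC (mem B)) s),
    perm_eq sB (seq.filter (mem B) s) & closed_length c sA + closed_length c sB
    <= closed_length c s
      + 2 * r * \sum_(i <- s) (~~ mem B i && mem B (next s i))%:R].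
  apply: (tour_separate c_ge0 c_triangle) => //.
  - by apply/hasP; exists v; rewrite ?(perm_mem ps) ?mem_cat ?vV //= VB.
  - by apply/hasP; exists p; rewrite ?(perm_mem ps) ?mem_cat ?pB ?orbT.
have fV : seq.filter (predC (mem B)) (V ++ B) = V.
  rewrite filter_cat (_ : seq.filter _ B = [::]) ?cats0.
    by apply/all_filterP/allP.
  by apply/eqP; rewrite -[_ == _]negbK -has_filter; apply/hasPn => i; rewrite /= negbK.
have fB' : seq.filter (mem B) (V ++ B) = B.
  rewrite filter_cat (_ : seq.filter _ V = [::]) /=.
    by apply/all_filterP/allP.
  by apply/eqP; rewrite -[_ == _]negbK -has_filter; apply/hasPn => i /VB.
have {}pA : perm_eq sA V.
  by apply: perm_trans pA _; rewrite -[X in perm_eq _ X]fV; apply: perm_filter.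
have {}pB' : perm_eq sB B.
  by apply: perm_trans pB' _; rewrite -[X in perm_eq _ X]fB'; apply: perm_filter.
have [t pt ot] := ex_optimal_tour c sA.
have [w fw cw] := IH t (perm_trans pt pA) ot.
exists ((v, q, 1) :: split_edges v p w ++ z).
  exact: (fractional_tour_insert VB vV yV yv pq fw fB).
rewrite wsum_cons wsum_cat mul1r.
have := wsum_split_le p fw vV c_diag c_sym c_triangle.
have := ot sA; rewrite perm_sym => /(_ pt).
have := lB _ pB'.
have r0 : 0 <= r by rewrite -(c_diag p) diam.
have : 2 * r * (\sum_(i <- s) (~~ mem B i && mem B (next s i))%:R) <= 2 * r * #|T|.+1%:R.
  rewrite ler_wpM2l ?mulr_ge0//.
  apply: (few_entries (cell := cell) (v := v) us opt pB diam) => // i j si sj iB jB iv jv.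
  have sV k : k \in s -> k \notin B -> k \in X.
    by rewrite (perm_mem ps) mem_cat => /orP[/VX//|->].
  by apply: far => //; apply: sV.
move: le cw; set e := \sum_(_ <- _) _; lra.
Qed.

End ClusterReduction.

(** * From weighted edge lists to the Held-Karp program *)

Section LinearProgram.
Context {R : realType} (V : finType) (c : V -> V -> R).
Context (c_ge0 : forall i j, 0 <= c i j) (c_diag : forall i, c i i = 0)
  (c_sym : forall i j, c i j = c j i).

Lemma tour_lengthE (s : seq V) : is_tour s -> tour_length c s = closed_length c s.
Proof. by move=> ps; rewrite /tour_length sum_next// (perm_uniq ps) enum_uniq. Qed.

Lemma edge_cost_ge0 (e : {set V}) : 0 <= edge_cost c e.
Proof.
rewrite /edge_cost mulr_ge0 ?invr_ge0//; apply: sumr_ge0 => i _.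
by apply: sumr_ge0.
Qed.

(** Repeated edges of the list add up; loops fall on singletons, which are not edges. *)
Definition edge_weight (w : seq (V * V * R)) (e : {set V}) : R :=
  \sum_(t <- w) t.2 * (e == [set t.1.1; t.1.2]%SET)%:R.

Lemma sum_edge_weight (w : seq (V * V * R)) (P : pred {set V}) (F : {set V} -> R) :
  \sum_(e : {set V} | P e) F e * edge_weight w e =
  \sum_(t <- w) t.2 * ((P [set t.1.1; t.1.2]%SET)%:R * F [set t.1.1; t.1.2]%SET).
Proof.
under eq_bigr do rewrite mulr_sumr.
rewrite exchange_big /=; apply: eq_bigr => t _.
rewrite big_mkcond (bigD1 [set t.1.1; t.1.2]%SET)//= eqxx big1 ?addr0.
  by case: ifP; rewrite ?mul0r ?mulr0// mulr1 mul1r mulrC.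
by move=> e /negbTE->; rewrite !mulr0; case: ifP.
Qed.

Lemma degree_sep (i u v : V) :
  \sum_(j : V | j != i) ([set i; j]%SET == [set u; v]%SET)%:R
  = sep (pred1 i) u v :> R.
Proof.
have pairE a b x : x != a -> ([set a; x]%SET == [set a; b]%SET) = (x == b).
  move=> xa; apply/eqP/eqP => [e|->//].
  have : x \in [set a; b]%SET by rewrite -e !inE eqxx orbT.
  by rewrite !inE (negbTE xa) => /eqP.
have key a b : a != b ->
  \sum_(j : V | j != a) ([set a; j]%SET == [set a; b]%SET)%:R = 1 :> R.
  move=> ab; rewrite (bigD1 b) 1?eq_sym//= eqxx big1 ?addr0// => x /andP[xa xb].
  by rewrite pairE// (negbTE xb).
have [->|ui] := eqVneq u i.
  have [->|vi] := eqVneq v i; last by rewrite /sep /= eqxx (negbTE vi) key// eq_sym.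
  rewrite sepxx big1// => j ji; case: eqP => // e.
  have : j \in [set i; i]%SET by rewrite -e !inE eqxx orbT.
  by rewrite !inE orbb (negbTE ji).
have [->|vi] := eqVneq v i.
  by rewrite /sep /= eqxx (negbTE ui) finset.setUC key// eq_sym.
rewrite /sep /= (negbTE ui) (negbTE vi) eqxx big1// => j ji; case: eqP => // e.
have : i \in [set u; v]%SET by rewrite -e !inE eqxx.
by rewrite !inE ![i == _]eq_sym (negbTE ui) (negbTE vi).
Qed.

Lemma edge_weight_feasible (w : seq (V * V * R)) : (2 < #|V|)%N ->
  fractional_tour (enum V) w -> HK_feasible (edge_weight w).
Proof.
move=> V3 [wV deg cut].
have w0 e : 0 <= edge_weight w e.
  rewrite /edge_weight big_seq; apply: sumr_ge0 => t /wV[_ _ t0].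
  by rewrite mulr_ge0.
(* The degrees in S count inner edges twice and cut edges once; hence the cut form and the subtour
   form of the constraints agree. *)
have inside (S : {set V}) :
  2 * \sum_(e : {set V} | is_edge e && (e \subset S)) edge_weight w e
  = 2 * #|S|%:R - wsum w (sep (mem S)).
  under eq_bigr do rewrite -[edge_weight w _]mul1r.
  rewrite (sum_edge_weight w _ (fun=> 1)).
  have -> : 2 * #|S|%:R = \sum_(i in S) wsum w (sep (pred1 i)).
    rewrite (eq_bigr (fun=> 2)) => [|i _]; last by rewrite deg// mem_enum.
    by rewrite sumr_const mulr_natr.
  rewrite /wsum exchange_big -sumrB mulr_sumr; apply: eq_bigr => t _ /=.
  rewrite -mulr_sumr -mulrBr mulrCA; congr (_ * _).
  case: t => [[u v] t] /=.
  rewrite mulr1 /is_edge cards2 finset.subUset !finset.sub1set.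
  have key x : \sum_(i in S) (x == i)%:R = (x \in S)%:R :> R.
    have [xS|xS] := boolP (x \in S).
      by rewrite (bigD1 x)//= eqxx big1 ?addr0// => i /andP[_]; rewrite eq_sym => /negbTE->.
    by rewrite big1// => i iS; case: eqP => // e; rewrite e iS in xS.
  have [->|uv] := eqVneq u v.
    by rewrite sepxx subr0 big1 ?mulr0// => i _; rewrite sepxx.
  have -> : \sum_(i in S) sep (pred1 i) u v = (u \in S)%:R + (v \in S)%:R :> R.
    rewrite -(key u) -(key v) -big_split; apply: eq_bigr => i _ /=.
    rewrite /sep /=; have [ui|_] := eqVneq u i; last by rewrite add0r; case: (v == i).
    by rewrite -ui [v == u]eq_sym (negbTE uv) addr0.
  by rewrite /sep /=; case: (u \in S); case: (v \in S); rewrite /=; lra.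
have subtour (S : {set V}) : S != finset.set0 -> S \proper [set: V]%SET ->
        \sum_(e : {set V} | is_edge e && (e \subset S)) edge_weight w e <= #|S|%:R - 1.
  move=> /set0Pn[i iS] /properP[_ [j _ jS]].
  have : 2 <= wsum w (sep (mem S)).
    apply: cut; apply/hasP; [exists i|exists j] => //; rewrite ?mem_enum//.
  by have := inside S; lra.
split=> // [i|e eE].
- rewrite -(deg i) ?mem_enum// /edge_weight exchange_big /=.
  by apply: eq_bigr => t _; rewrite -mulr_sumr degree_sep.
- rewrite w0 /=.
  (* The bound [x e <= 1] is the subtour constraint for the set e itself, which is proper since V
     has more than two elements. *)
  have e0 : e != finset.set0 by rewrite -card_gt0 (eqP eE).
  have eT : e \proper [set: V]%SET by rewrite properEcard finset.subsetT cardsT (eqP eE).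
  have := subtour e e0 eT; rewrite (eqP eE) (bigD1 e) ?eE ?subxx//=.
  have : 0 <= \sum_(i : {set V} | is_edge i && (i \subset e) && (i != e)) edge_weight w i.
    exact: sumr_ge0.
  lra.
Qed.

Lemma hk_value_le (w : seq (V * V * R)) : (2 < #|V|)%N ->
  fractional_tour (enum V) w -> hk_value c <= wsum w c.
Proof.
move=> V3 fw; have -> : wsum w c = HK_objective c (edge_weight w).
  rewrite /HK_objective sum_edge_weight /wsum; apply: eq_bigr => [[[u v] t] _] /=.
  rewrite /is_edge cards2; have [->|uv] := eqVneq u v; first by rewrite c_diag mul0r.
  by rewrite edge_cost_pair// mul1r.
apply: ge_inf; last by exists (edge_weight w) => //; exact: edge_weight_feasible.
exists 0 => _ [x [_ _ xb] <-]; apply: sumr_ge0 => e eE.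
by rewrite mulr_ge0 ?edge_cost_ge0//; case/andP: (xb e eE).
Qed.

Lemma tsp_value_ge (t : R) :
  (forall s : seq V, is_tour s -> t <= closed_length c s) -> t <= tsp_value c.
Proof.
move=> tle; apply: lb_le_inf.
  by exists (tour_length c (enum V)), (enum V) => //; exact: perm_refl.
by move=> _ [s st <-]; rewrite tour_lengthE//; exact: tle.
Qed.

End LinearProgram.

(** * Euclidean norm and directions *)

Section EuclideanNorm.
Context {R : realType} {d : nat}.
Implicit Types (a b : 'I_d -> R) (p q : Rpoint R d).

Definition enorm a : R := Num.sqrt (\sum_(k < d) a k ^+ 2).

Lemma enorm_ge0 a : 0 <= enorm a. Proof. exact: sqrtr_ge0. Qed.

Lemma sqr_enorm a : enorm a ^+ 2 = \sum_(k < d) a k ^+ 2.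
Proof. by rewrite sqr_sqrtr// sumr_ge0// => k _; exact: sqr_ge0. Qed.

Lemma eq_enorm a b : a =1 b -> enorm a = enorm b.
Proof. by move=> ab; congr Num.sqrt; apply: eq_bigr => k _; rewrite ab. Qed.

Lemma enormZ x a : enorm (fun k => x * a k) = `|x| * enorm a.
Proof.
rewrite /enorm; under eq_bigr do rewrite exprMn.
by rewrite -mulr_sumr sqrtrM ?sqr_ge0// sqrtr_sqr.
Qed.

Lemma enorm_coord a k : `|a k| <= enorm a.
Proof.
rewrite -(@ler_pXn2r _ 2)// ?nnegrE ?enorm_ge0//.
rewrite sqr_enorm real_normK ?num_real// (bigD1 k)//= lerDl.
by apply: sumr_ge0 => j _; exact: sqr_ge0.
Qed.

Lemma enorm_le a e : (forall k, `|a k| <= e) -> enorm a <= d%:R * e.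
Proof.
case: (posnP d) => [d0 _|d0 ae].
  rewrite /enorm big1 ?sqrtr0 ?d0 ?mul0r// => -[k kd].
  by exfalso; rewrite d0 in kd.
have e0 : 0 <= e by apply: le_trans (ae (Ordinal d0)).
rewrite -(@ler_pXn2r _ 2)// ?nnegrE ?enorm_ge0// ?mulr_ge0//.
rewrite sqr_enorm exprMn; apply: (@le_trans _ _ (\sum_(k < d) e ^+ 2)).
  apply: ler_sum => k _; rewrite -[leLHS]real_normK ?num_real//.
  by rewrite ler_pXn2r ?nnegrE.
rewrite sumr_const card_ord -[leLHS]mulr_natl ler_wpM2r ?sqr_ge0//.
by rewrite -natrX ler_nat expnS expn1 leq_pmulr.
Qed.

Lemma cauchy_schwarz a b : \sum_(k < d) a k * b k <= enorm a * enorm b.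
Proof.
have [a0|a0] := leP (enorm a) 0.
  rewrite big1 ?mulr_ge0 ?enorm_ge0// => k _.
  by have := le_trans (enorm_coord a k) a0; rewrite normr_le0 => /eqP->; rewrite mul0r.
have [b0|b0] := leP (enorm b) 0.
  rewrite big1 ?mulr_ge0 ?enorm_ge0// => k _.
  by have := le_trans (enorm_coord b k) b0; rewrite normr_le0 => /eqP->; rewrite mulr0.
have : 0 <= \sum_(k < d) (enorm b * a k - enorm a * b k) ^+ 2.
  by apply: sumr_ge0 => k _; exact: sqr_ge0.
have -> : \sum_(k < d) (enorm b * a k - enorm a * b k) ^+ 2 =
  2 * (enorm a * enorm b) * (enorm a * enorm b - \sum_(k < d) a k * b k).
  transitivity (\sum_(k < d) (enorm b ^+ 2 * a k ^+ 2 + enorm a ^+ 2 * b k ^+ 2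
                 - 2 * (enorm a * enorm b) * (a k * b k))).
    by apply: eq_bigr => k _; ring.
  by rewrite sumrB big_split -!mulr_sumr -!sqr_enorm /=; ring.
by rewrite pmulr_rge0 ?mulr_gt0// subr_ge0.
Qed.

Lemma enormD a b : enorm (fun k => a k + b k) <= enorm a + enorm b.
Proof.
rewrite -(@ler_pXn2r _ 2)// ?nnegrE ?addr_ge0 ?enorm_ge0//.
rewrite sqr_enorm sqrrD !sqr_enorm.
under eq_bigr do rewrite sqrrD.
rewrite !big_split /= mulr2n.
by have := cauchy_schwarz a b; lra.
Qed.

Lemma eucl_distE p q : eucl_dist p q = enorm (fun k => tnth p k - tnth q k).
Proof. by []. Qed.

Lemma eucl_dist_ge0 p q : 0 <= eucl_dist p q. Proof. exact: enorm_ge0. Qed.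

Lemma eucl_distxx p : eucl_dist p p = 0.
Proof.
by rewrite eucl_distE /enorm big1 ?sqrtr0// => k _; rewrite subrr expr0n.
Qed.

Lemma eucl_dist_sym p q : eucl_dist p q = eucl_dist q p.
Proof. by congr Num.sqrt; apply: eq_bigr => k _; rewrite -opprB sqrrN. Qed.

Lemma eucl_dist_triangle p q s : eucl_dist p s <= eucl_dist p q + eucl_dist q s.
Proof.
rewrite !eucl_distE; apply: le_trans (enormD _ _).
by rewrite le_eqVlt; apply/orP; left; apply/eqP/eq_enorm => k; rewrite addrA subrK.
Qed.

(* Vectors of the same cell make an angle less than pi/3. *)
Definition direction_cell a : {ffun 'I_d -> 'I_(4 * d).+1} :=
  [ffun k => inord (Num.truncn ((a k / enorm a + 1) * (2 * d%:R)))].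

Lemma same_direction a b : direction_cell a = direction_cell b ->
  enorm b <= enorm a -> enorm (fun k => a k - b k) <= enorm a - 2^-1 * enorm b.
Proof.
move=> /ffunP cE ba.
have [b0|b0] := leP (enorm b) 0.
  have b00 : enorm b = 0 by apply/eqP; rewrite eq_le b0 enorm_ge0.
  rewrite b00 mulr0 subr0 (@eq_enorm _ a)// => k.
  have := le_trans (enorm_coord b k) b0; rewrite normr_le0 => /eqP->.
  by rewrite subr0.
have a0 : 0 < enorm a by apply: lt_le_trans ba.
have u1 a' k : 0 < enorm a' -> 0 <= a' k / enorm a' + 1 <= 2.
  move=> a'0; have := enorm_coord a' k; rewrite ler_norml => /andP[h1 h2].
  have : -1 <= a' k / enorm a' by rewrite ler_pdivlMr// mulN1r.
  have : a' k / enorm a' <= 1 by rewrite ler_pdivrMr// mul1r.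
  lra.
have close k : `|a k / enorm a - b k / enorm b| <= (2 * d%:R)^-1.
  have d0 : 0 < 2 * d%:R :> R.
    by rewrite mulr_gt0// ltr0n; case: d k => // -[].
  have tr a' : 0 < enorm a' ->
     (direction_cell a' k)%:R <= (a' k / enorm a' + 1) * (2 * d%:R)
       < (direction_cell a' k)%:R + 1.
    move=> a'0; set x := _ * _; have /andP[x0 x2] := u1 a' k a'0.
    have x0' : 0 <= x by rewrite mulr_ge0// ltW.
    have xle : x <= (4 * d)%:R.
      rewrite /x natrM -[4%N]/(2 * 2)%N natrM -mulrA ler_pM2r//.
    rewrite ffunE inordK; last first.
      by rewrite ltnS -(ler_nat R); apply: le_trans xle; rewrite truncn_le.
    by rewrite natr1 truncn_itv.
  have := tr a a0; have := tr b b0; rewrite /= cE.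
  set n := (_ : nat)%:R; set x := a k / _; set y := b k / _ => h1 h2.
  rewrite -[(2 * d%:R)^-1]mul1r ler_pdivlMr// -[X in _ * X]gtr0_norm// -normrM.
  rewrite ler_norml; apply/andP; split; lra.
(* First shrink a to the length of b, then turn it. The unit vectors differ by at most 1/(2d) in
   each coordinate, hence by at most 1/2 in norm. *)
have -> : enorm (fun k => a k - b k) = enorm (fun k =>
   (1 - enorm b / enorm a) * a k + enorm b * (a k / enorm a - b k / enorm b)).
  by apply: eq_enorm => k; field; rewrite !gt_eqF.
apply: le_trans (enormD _ _) _.
rewrite !enormZ (gtr0_norm b0) ger0_norm; last first.
  by rewrite subr_ge0 ler_pdivrMr// mul1r.
have := enorm_le close; set w := enorm _ => wle.
have {}wle : w <= 2^-1.
  apply: le_trans wle _; rewrite invfM mulrCA.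
  by have [->|d0] := posnP d; rewrite ?mul0r ?mulr0// mulfV ?mulr1// pnatr_eq0 -lt0n.
have : enorm b * w <= enorm b * 2^-1 by rewrite ler_pM2l.
by rewrite mulrBl mul1r -mulrA mulVf ?mulr1 ?gt_eqF//; lra.
Qed.

(** By [same_direction] the detour through [o] exceeds the direct distance by at least 3/2 of the
    smaller distance to [o], which is more than 3r. *)
Lemma same_direction_dist p q o r :
  direction_cell (fun k => tnth p k - tnth o k)
  = direction_cell (fun k => tnth q k - tnth o k) ->
  2 * r < eucl_dist p o -> 2 * r < eucl_dist q o ->
  eucl_dist p q + 3 * r < eucl_dist p o + eucl_dist q o.
Proof.
wlog qp : p q / eucl_dist q o <= eucl_dist p o => [wl|].
  have [/wl|/ltW/wl h cE hp hq] := leP (eucl_dist q o) (eucl_dist p o); first by [].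
  by rewrite eucl_dist_sym [ltRHS]addrC; apply: h.
move=> /same_direction/(_ qp) + _ => h; rewrite (eucl_distE p q).
rewrite (@eq_enorm _ (fun k => (tnth p k - tnth o k) - (tnth q k - tnth o k))).
  by move: h; rewrite -!eucl_distE; lra.
by move=> k; rewrite opprB addrA subrK.
Qed.

End EuclideanNorm.

Section FiniteSets.
Context {R : realType} {d : nat}.

Lemma HK_TSP_gap (X : {fset Rpoint R d}) (s : seq (Rpoint R d)) (g : R) :
  (2 < #|` X|)%N -> perm_eq s X -> optimal_tour (@eucl_dist R d) s ->
  fractional_le (@eucl_dist R d) X (closed_length (@eucl_dist R d) s - g) ->
  HK X + g <= TSP X.
Proof.
move=> X3 ps opt [w fw wle].
pose c := fun i j : X => eucl_dist (val i) (val j).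
have TS : closed_length (@eucl_dist R d) s <= TSP X.
  apply: tsp_value_ge => t /= pt.
  have -> : closed_length c t = closed_length (@eucl_dist R d) (map val t).
    by rewrite closed_length_map.
  apply: opt; apply: perm_trans (perm_map val pt) _.
  rewrite perm_sym (perm_trans ps)// uniq_perm ?fset_uniq//.
    by rewrite (map_inj_uniq val_inj) enum_uniq.
  move=> x; apply/idP/mapP => [xX|[y _ ->]]; last exact: valP.
  by exists [` xX]%fset; rewrite ?mem_enum.
suff : HK X <= wsum w (@eucl_dist R d) by move: wle; lra.
have [x0 xX] : exists x, x \in X by apply/fset0Pn; rewrite -cardfs_gt0 (ltn_trans _ X3).
pose f p : X := insubd [` xX]%fset p.
have fK : {in X, cancel f val} by move=> p pX; rewrite /f insubdK.
have fI : {in X &, injective f}.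
  by move=> p q pX qX /(congr1 val); rewrite !fK.
have := fractional_tour_map fI fw => ff.
have {}ff : fractional_tour (enum {: X}) [seq (f e.1.1, f e.1.2, e.2) | e <- w].
  apply: fractional_tour_perm ff => i; rewrite mem_enum.
  apply/mapP; exists (val i); first exact: valP.
  by apply: val_inj; rewrite fK//; exact: valP.
apply: (@le_trans _ _ (wsum [seq (f e.1.1, f e.1.2, e.2) | e <- w] c)).
  apply: hk_value_le => //; last by rewrite -cardfE.
  - by move=> i j; exact: eucl_dist_ge0.
  - by move=> i; exact: eucl_distxx.
  - by move=> i j; exact: eucl_dist_sym.
have [wV _ _] := fw.
rewrite /wsum big_map big_seq [leRHS]big_seq; apply: ler_sum => e /wV[e1 e2 _] /=.
by rewrite /c !fK.
Qed.

End FiniteSets.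

(** * The planar lattice of gadgets *)

Local Open Scope nat_scope.

(* The site [((i, j), k)] is point number [k] of the gadget in row [i] and column
   [j]. In a gadget, [1], [2], [3] and [6], [7], [8] form triangles, two parallel
   paths [2], [4], [6] and [3], [5], [7] join them, and [0] is the point that
   links [1] to point [8] of the previous gadget of the row. *)
Definition site : Type := (nat * nat) * nat.

(** Each triangle consists of two 3-4-5 right triangles, so that discs of radii 2, 3, 3 around its
    corners touch at integer distances 5, 5, 6. With the period 22, point 8 touches point 0 of the
    next gadget; the period 13 keeps different rows at distance at least 7. *)
Definition gadget_x (k : nat) : nat := nth 0 [:: 0; 3; 7; 7; 11; 11; 15; 15; 19] k.
Definition gadget_y (k : nat) : nat := nth 0 [:: 3; 3; 6; 0; 6; 0; 6; 0; 3] k.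
Definition gadget_r (k : nat) : nat := nth 0 [:: 1; 2; 3; 3; 1; 1; 3; 3; 2] k.

Definition site_x (u : site) : nat := 22 * u.1.2 + gadget_x u.2.
Definition site_y (u : site) : nat := 13 * u.1.1 + gadget_y u.2.
Definition site_r (u : site) : nat := gadget_r u.2.

(** The square of the difference: subtraction is truncated, so one of the two terms vanishes. *)
Definition sqdiff (a b : nat) : nat := (a - b) ^ 2 + (b - a) ^ 2.

Definition sqdist (u v : site) : nat :=
  sqdiff (site_x u) (site_x v) + sqdiff (site_y u) (site_y v).

Definition tight (u v : site) : bool := sqdist u v == (site_r u + site_r v) ^ 2.

Lemma leq_sqdiff m a b : a + m <= b -> m ^ 2 <= sqdiff a b.
Proof. by move=> h; rewrite /sqdiff -[_ ^ 2]add0n leq_add// leq_sqr; lia. Qed.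

Lemma sqdiffC a b : sqdiff a b = sqdiff b a.
Proof. by rewrite /sqdiff addnC. Qed.

Lemma sqdistC u v : sqdist u v = sqdist v u.
Proof. by rewrite /sqdist sqdiffC [X in _ + X]sqdiffC. Qed.

Lemma gadget_bounds k : k < 9 ->
  [&& gadget_x k <= 19, gadget_y k <= 6, gadget_r k <= 3 & 0 < gadget_r k].
Proof.
move: k; have : all (fun k => [&& gadget_x k <= 19, gadget_y k <= 6, gadget_r k <= 3 &
  0 < gadget_r k]) (iota 0 9) by [].
by move=> /allP h k k9; apply: h; rewrite mem_iota.
Qed.

Lemma forall_lt9 (P : nat -> nat -> bool) :
  all (fun i => all (P i) (iota 0 9)) (iota 0 9) ->
  forall i j, i < 9 -> j < 9 -> P i j.
Proof.
move=> /allP h i j i9 j9; have /h/allP : i \in iota 0 9 by rewrite mem_iota.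
by apply; rewrite mem_iota.
Qed.

Lemma sqdiffD m a b : sqdiff (m + a) (m + b) = sqdiff a b.
Proof. by rewrite /sqdiff !subnDl. Qed.

Definition local_sqdist (s k l : nat) : nat :=
  sqdiff (gadget_x k) (s + gadget_x l) + sqdiff (gadget_y k) (gadget_y l).

Lemma sqdist_same c k l : sqdist (c, k) (c, l) = local_sqdist 0 k l.
Proof. by rewrite /sqdist /site_x /site_y !sqdiffD. Qed.

Lemma sqdist_next i j k l :
  sqdist ((i, j), k) ((i, j.+1), l) = local_sqdist 22 k l.
Proof. by rewrite /sqdist /site_x /site_y /= mulnS [22 + _]addnC -addnA !sqdiffD. Qed.

(** The bound 49 is (3 + 3 + 1)^2, where 3 is the largest radius: far pairs satisfy every distance
    requirement, and only two finite tables remain to be checked. *)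
Variant site_pair_spec (u v : site) : Prop :=
  | SiteSame of u.1 = v.1
  | SiteNext of v.1 = (u.1.1, u.1.2.+1)
  | SitePrev of u.1 = (v.1.1, v.1.2.+1)
  | SiteFar of 49 <= sqdist u v.

Lemma site_pairP u v : u.2 < 9 -> v.2 < 9 -> site_pair_spec u v.
Proof.
move=> /gadget_bounds/and4P[xu yu _ _] /gadget_bounds/and4P[xv yv _ _].
have farx : site_x u + 7 <= site_x v \/ site_x v + 7 <= site_x u ->
    site_pair_spec u v.
  move=> h; apply: SiteFar; apply: leq_trans (leq_addr _ _).
  by case: h => /leq_sqdiff //; rewrite sqdiffC.
have fary : site_y u + 7 <= site_y v \/ site_y v + 7 <= site_y u ->
    site_pair_spec u v.
  move=> h; apply: SiteFar; apply: leq_trans (leq_addl _ _).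
  by case: h => /leq_sqdiff //; rewrite sqdiffC.
case: u v xu yu xv yv farx fary => [[i j] k] [[i' j'] k'] /= xu yu xv yv.
rewrite /site_x /site_y /= => farx fary.
have [ii|ii|ii] := ltngtP i i'; [by apply: fary; lia|by apply: fary; lia|].
rewrite -{i'}ii in farx fary *.
have [jj|jj|<-] := ltngtP j j'; last exact: SiteSame.
- have [<-|ne] := eqVneq j.+1 j'; first exact: SiteNext.
  by apply: farx; lia.
- have [<-|ne] := eqVneq j'.+1 j; first exact: SitePrev.
  by apply: farx; lia.
Qed.

(* The discs of radius [site_r] around the sites have disjoint interiors; those
   that are not tangent are at distance at least 1. *)
Lemma sqdist_ge u v : u.2 < 9 -> v.2 < 9 -> u != v ->
  (site_r u + site_r v + ~~ tight u v) ^ 2 <= sqdist u v.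
Proof.
move=> u9 v9 uv.
have same : forall k l, k < 9 -> l < 9 -> (k != l) ==>
  ((gadget_r k + gadget_r l + (local_sqdist 0 k l != (gadget_r k + gadget_r l) ^ 2)) ^ 2
    <= local_sqdist 0 k l) by apply: forall_lt9; vm_compute.
have next : forall k l, k < 9 -> l < 9 ->
  ((gadget_r k + gadget_r l + (local_sqdist 22 k l != (gadget_r k + gadget_r l) ^ 2)) ^ 2
    <= local_sqdist 22 k l) by apply: forall_lt9; vm_compute.
case: (site_pairP u9 v9).
- case: u v uv u9 v9 => [c k] [c' l] /= uv u9 v9 cc.
  rewrite -{c'}cc in uv *; rewrite /tight sqdist_same.
  have /implyP := same k l u9 v9; apply.
  by apply: contraNneq uv => ->.
- case: u v uv u9 v9 => [[i j] k] [c' l] /= uv u9 v9 cc.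
  by rewrite {}cc /tight sqdist_next next.
- case: u v uv u9 v9 => [c k] [[i j] l] /= uv u9 v9 cc.
  rewrite {}cc /tight sqdistC sqdist_next [site_r _ + site_r _]addnC.
  exact: next.
- move=> far; apply: leq_trans far; rewrite -[49]/(7 ^ 2) leq_sqr.
  move: u9 v9 => /gadget_bounds/and4P[_ _ ru _] /gadget_bounds/and4P[_ _ rv _].
  exact: leq_add (leq_add ru rv) (leq_b1 _).
Qed.

(** Points 0 to 5 suffice because one triangle per gadget is used. Only an inclusion is claimed, so
    the spurious candidate for point 0 in column 0, where [c.2.-1] is 0, is harmless. *)
Lemma tight_corner c k v : k < 6 -> v.2 < 9 -> (c, k) != v -> tight (c, k) v ->
  v \in nth [::] [:: [:: (c, 1); ((c.1, c.2.-1), 8)];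
    [:: (c, 0); (c, 2); (c, 3)]; [:: (c, 1); (c, 3); (c, 4)];
    [:: (c, 1); (c, 2); (c, 5)]; [:: (c, 2); (c, 6)]; [:: (c, 3); (c, 7)]] k.
Proof.
move=> k6 v9 kv tkv; have k9 : k < 9 by apply: ltn_trans k6 _.
pose nbr := [:: [:: 1]; [:: 0; 2; 3]; [:: 1; 3; 4]; [:: 1; 2; 5];
  [:: 2; 6]; [:: 3; 7]].
have same : forall k l, k < 9 -> l < 9 -> [&& k < 6, k != l &
   local_sqdist 0 k l == (gadget_r k + gadget_r l) ^ 2] ==> (l \in nth [::] nbr k).
  by apply: forall_lt9; vm_compute.
have next : forall k l, k < 9 -> l < 9 ->
   (local_sqdist 22 k l == (gadget_r k + gadget_r l) ^ 2) ==> (k == 8) && (l == 0).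
  by apply: forall_lt9; vm_compute.
case: (site_pairP (u := (c, k)) k9 v9).
- case: v v9 kv tkv => [c' l] /= v9 kv + cc.
  rewrite -{c'}cc /tight sqdist_same in kv * => tkl.
  have kl : k != l by apply: contraNneq kv => ->.
  have /implyP := same k l k9 v9; rewrite k6 kl tkl => /(_ isT).
  move: k6 {k9 kv tkl kl}; do 6?[case: k => [|k] //=]; rewrite !inE => _ h;
    repeat (case/orP: h => h); by rewrite (eqP h) ?eqxx ?orbT.
- case: v v9 kv tkv => [c' l] /= v9 _ + cc.
  case: c cc => i j -> /=; rewrite /tight sqdist_next => tkl.
  have /implyP := next k l k9 v9; rewrite tkl => /(_ isT).
  by case/andP => /eqP e; rewrite e in k6.
- case: v v9 kv tkv => [[i j] l] /= v9 _ + cc.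
  rewrite {}cc /tight sqdistC sqdist_next addnC => tkl.
  have /implyP := next l k v9 k9; rewrite tkl => /(_ isT) /andP[/eqP-> /eqP->] /=.
  by rewrite !inE eqxx orbT.
- move=> far; move: tkv; rewrite /tight => /eqP e; move: far; rewrite e.
  have /gadget_bounds/and4P[_ _ ru _] := k9; have /gadget_bounds/and4P[_ _ rv _] := v9.
  by rewrite -[49]/(7 ^ 2) leq_sqr => /leq_trans/(_ (leq_add ru rv)).
Qed.

(** * The parity obstruction at a triangle *)

Section Neighbours.
Context {T : eqType} (s : seq T).
Context (us : uniq s) (s3 : 2 < size s).

Lemma next_neq_prev u : u \in s -> next s u != prev s u.
Proof.
move=> su; apply/eqP => /(congr1 (next s)); rewrite next_prev//.
have [i s' rs] := rot_to su.
have us' : uniq (u :: s') by rewrite -rs rot_uniq.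
have : 2 < size (u :: s') by rewrite -rs size_rot.
rewrite -!(next_rot i us) rs.
case: s' us' {rs} => [|v [|w p]] // us' _.
rewrite next_head [head _ _]/= -(next_rot 1 us') rot1_cons next_head /=.
by move=> e; move: us'; rewrite e /= !inE eqxx orbT.
Qed.

Definition adjacent u v := (next s u == v) || (prev s u == v).

Lemma adjacentC u v : adjacent u v = adjacent v u.
Proof.
have nextE x y : (next s x == y) = (prev s y == x).
  by rewrite (can2_eq (prev_next us) (next_prev us)) eq_sym.
by rewrite /adjacent (nextE u) (nextE v) orbC.
Qed.

Lemma adjacent_path2 x y z : x \in s ->
  {subset [:: next s x; prev s x] <= [:: y; z]} -> adjacent x y.
Proof.
move=> sx sub; have := next_neq_prev sx; rewrite /adjacent.
have := sub (next s x); have := sub (prev s x).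
rewrite !inE !eqxx orbT => /(_ isT)/orP[]/eqP-> /(_ isT)/orP[]/eqP->;
  by rewrite ?eqxx ?orbT.
Qed.

Lemma adjacent_triangle x y z n : x \in s -> uniq [:: y; z; n] ->
  {subset [:: next s x; prev s x] <= [:: y; z; n]} -> adjacent x n ->
  adjacent x y = ~~ adjacent x z.
Proof.
rewrite /= !inE negb_or => sx /and3P[/andP[yz yn] zn _] sub.
have [zy ny nz] : [/\ z != y, n != y & n != z] by rewrite ![_ == y]eq_sym (eq_sym n) yz yn.
have := next_neq_prev sx; rewrite /adjacent.
have := sub (next s x); have := sub (prev s x); rewrite !inE !eqxx orbT.
by move=> /(_ isT)/or3P[]/eqP-> /(_ isT)/or3P[]/eqP->; rewrite ?eqxx ?(negbTE yz)
  ?(negbTE yn) ?(negbTE zn) ?(negbTE zy) ?(negbTE ny) ?(negbTE nz).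
Qed.

(* Parity: the tour would have to use each pendant edge and then match up the
   three vertices of the triangle. *)
Lemma no_tight_triangle a b c na nb nc a' b' c' :
  all (mem s) [:: a; b; c; na; nb; nc] -> uniq [:: a; b; c; na; nb; nc] ->
  {subset [:: next s a; prev s a] <= [:: b; c; na]} ->
  {subset [:: next s b; prev s b] <= [:: a; c; nb]} ->
  {subset [:: next s c; prev s c] <= [:: a; b; nc]} ->
  {subset [:: next s na; prev s na] <= [:: a; a']} ->
  {subset [:: next s nb; prev s nb] <= [:: b; b']} ->
  {subset [:: next s nc; prev s nc] <= [:: c; c']} -> False.
Proof.
move=> /= /and5P[sa sb sc sna /and3P[snb snc _]].
rewrite !inE !negb_or => /and5P[/and5P[ab ac ana anb anc]].
move=> /and4P[bc bna bnb bnc] /and3P[cna cnb cnc] _ _ Ha Hb Hc Hna Hnb Hnc.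
have Aa := adjacent_path2 sna Hna; have Ab := adjacent_path2 snb Hnb.
have Ac := adjacent_path2 snc Hnc.
have u1 : uniq [:: b; c; na] by rewrite /= !inE negb_or bc bna cna.
have u2 : uniq [:: a; c; nb] by rewrite /= !inE negb_or ac anb cnb.
have u3 : uniq [:: a; b; nc] by rewrite /= !inE negb_or ab anc bnc.
rewrite adjacentC in Aa; rewrite adjacentC in Ab; rewrite adjacentC in Ac.
have := adjacent_triangle sa u1 Ha Aa; have := adjacent_triangle sb u2 Hb Ab.
have := adjacent_triangle sc u3 Hc Ac.
rewrite (adjacentC c a) (adjacentC c b) (adjacentC b a).
(* Each corner has exactly one tour neighbour in the triangle, which would give the triangle 3/2
   tour edges. *)
by case: (adjacent a b); case: (adjacent a c); case: (adjacent b c).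
Qed.

End Neighbours.

(** * Lower bound for tours of the lattice *)

Definition cells (L : nat) : seq (nat * nat) :=
  [seq (i, j) | i <- iota 0 L, j <- iota 0 L].

Definition gadget (c : nat * nat) : seq site := [seq (c, k) | k <- iota 0 9].

Definition lattice (L : nat) : seq site := flatten (map gadget (cells L)).

Arguments cells : simpl never.
Arguments gadget : simpl never.

Lemma mem_cells L c : (c \in cells L) = (c.1 < L) && (c.2 < L).
Proof.
apply/allpairsP/andP => [[[i j] /= [+ + ->]]|[c1 c2]].
  by rewrite !mem_iota.
by exists c; rewrite !mem_iota; case: c c1 c2.
Qed.

Lemma cells_uniq L : uniq (cells L).
Proof. by apply: allpairs_uniq; rewrite ?iota_uniq// => -[? ?] [? ?]. Qed.

Lemma size_cells L : size (cells L) = L ^ 2.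
Proof. by rewrite size_allpairs !size_iota. Qed.

Lemma mem_gadget c u : (u \in gadget c) = (u.1 == c) && (u.2 < 9).
Proof.
apply/mapP/andP => [[k + ->]|[/eqP <- u9]]; first by rewrite mem_iota eqxx.
by exists u.2; rewrite ?mem_iota//; case: u u9.
Qed.

Lemma gadget_uniq c : uniq (gadget c).
Proof. by rewrite map_inj_uniq ?iota_uniq// => ? ? []. Qed.

Lemma mem_flatten_gadget cs u :
  (u \in flatten (map gadget cs)) = (u.1 \in cs) && (u.2 < 9).
Proof.
apply/flatten_mapP/andP => [[c cc]|[u1 u2]]; rewrite ?mem_gadget.
  by case/andP => /eqP->.
by exists u.1; rewrite ?mem_gadget ?eqxx.
Qed.

Lemma flatten_gadget_uniq cs : uniq cs -> uniq (flatten (map gadget cs)).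
Proof.
elim: cs => // c cs IH /andP[ccs ucs].
rewrite -[flatten _]/(gadget c ++ flatten (map gadget cs)) cat_uniq gadget_uniq IH// andbT.
apply/hasPn => u.
rewrite mem_flatten_gadget mem_gadget => /andP[u1 _].
by apply/negP => /andP[/eqP e _]; rewrite e (negbTE ccs) in u1.
Qed.

Lemma mem_lattice L u : (u \in lattice L) = [&& u.1.1 < L, u.1.2 < L & u.2 < 9].
Proof. by rewrite mem_flatten_gadget mem_cells andbA. Qed.

Lemma lattice_uniq L : uniq (lattice L).
Proof. exact/flatten_gadget_uniq/cells_uniq. Qed.

Lemma size_lattice L : size (lattice L) = 9 * L ^ 2.
Proof.
rewrite -size_cells /lattice size_flatten.
by elim: (cells L) => //= c cs IH; rewrite IH mulnS.
Qed.

Section LatticeTours.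
Context (L : nat) (s : seq site).
Context (ps : perm_eq s (lattice L)).

Let us : uniq s. Proof. by rewrite (perm_uniq ps) lattice_uniq. Qed.

Let mem_s u : (u \in s) = [&& u.1.1 < L, u.1.2 < L & u.2 < 9].
Proof. by rewrite (perm_mem ps) mem_lattice. Qed.

Lemma perm_map_next : perm_eq (map (next s) s) s.
Proof.
apply: uniq_perm => //; first by rewrite (map_inj_uniq (can_inj (prev_next us))).
move=> u; apply/mapP/idP => [[v vs ->]|us']; first by rewrite mem_next.
by exists (prev s u); rewrite ?mem_prev ?next_prev.
Qed.

Let loose u v : nat := ~~ tight u v.

Lemma loose_gadget c : c \in cells L ->
  0 < \sum_(u <- gadget c) (loose u (next s u) + loose u (prev s u)).
Proof.
rewrite mem_cells => /andP[c1 c2]; rewrite lt0n; apply/negP => /eqP sum0.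
have s3 : 2 < size s.
  have : size (gadget c) <= size s.
    apply: uniq_leq_size (gadget_uniq c) _ => u; rewrite mem_gadget mem_s.
    by case/andP => /eqP-> ->; rewrite c1 c2.
  by rewrite size_map size_iota; apply: leq_trans.
have cs k : k < 9 -> (c, k) \in s by rewrite mem_s c1 c2.
have tk k : k < 9 -> tight (c, k) (next s (c, k)) && tight (c, k) (prev s (c, k)).
  move=> k9; have kc : (c, k) \in gadget c by rewrite mem_gadget eqxx.
  move/eqP: sum0; rewrite sum_nat_seq_eq0 => /allP/(_ _ kc).
  by rewrite implyTb addn_eq0 !eqb0 !negbK.
have corner k : k < 6 -> {subset [:: next s (c, k); prev s (c, k)] <=
    nth [::] [:: [:: (c, 1); ((c.1, c.2.-1), 8)];
    [:: (c, 0); (c, 2); (c, 3)]; [:: (c, 1); (c, 3); (c, 4)];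
    [:: (c, 1); (c, 2); (c, 5)]; [:: (c, 2); (c, 6)]; [:: (c, 3); (c, 7)]] k}.
  move=> k6; have k9 : k < 9 by apply: ltn_trans k6 _.
  have nk : next s (c, k) != (c, k).
    apply/eqP => e; have := next_neq_prev us s3 (cs k k9).
    by rewrite e -[in prev _ _]e prev_next ?eqxx.
  have pk : prev s (c, k) != (c, k).
    apply/eqP => e; have := next_neq_prev us s3 (cs k k9).
    by rewrite e -[in next _ _]e next_prev ?eqxx.
  have /andP[tn tp] := tk k k9.
  move=> v; rewrite !inE => /orP[]/eqP->; apply: tight_corner => //; rewrite 1?eq_sym//.
  - by have := mem_next s (c, k); rewrite cs// mem_s => /and3P[].
  - by have := mem_prev s (c, k); rewrite cs// mem_s => /and3P[].
apply: (@no_tight_triangle _ s us s3 (c, 1) (c, 2) (c, 3) (c, 0) (c, 4) (c, 5)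
   ((c.1, c.2.-1), 8) (c, 6) (c, 7)).
- by rewrite /= !cs.
- by rewrite /= !inE !xpair_eqE !eqxx.
- move=> v /corner -/(_ isT); rewrite /= !inE.
  by case/or3P => ->; rewrite ?orbT.
- move=> v /corner -/(_ isT); rewrite /= !inE.
  by case/or3P => ->; rewrite ?orbT.
- by move=> v /corner -/(_ isT).
- by move=> v /corner -/(_ isT).
- by move=> v /corner -/(_ isT).
- by move=> v /corner -/(_ isT).
Qed.

(** Every gadget meets a loose tour edge, and summing over both ends counts each loose edge
    twice. *)
Lemma loose_count : L ^ 2 <= 2 * \sum_(u <- s) loose u (next s u).
Proof.
have -> : 2 * (\sum_(u <- s) loose u (next s u)) =
  \sum_(u <- s) (loose u (next s u) + loose u (prev s u)).
  rewrite big_split mul2n -addnn; congr (_ + _).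
  rewrite -[RHS](perm_big _ perm_map_next).
  rewrite big_map; apply: eq_bigr => u _.
  by rewrite prev_next// /loose /tight sqdistC addnC.
rewrite (perm_big _ ps) /= big_flatten big_map -size_cells -sum1_size.
rewrite big_seq [leqRHS]big_seq; apply: leq_sum => c cL.
exact: loose_gadget.
Qed.

Local Open Scope ring_scope.

Lemma sum_site_r : (\sum_(u <- s) site_r u = 19 * L ^ 2)%N.
Proof.
rewrite (perm_big _ ps) /= big_flatten big_map.
rewrite (eq_bigr (fun=> 19%N)) => [|c _]; last by rewrite big_map unlock.
by rewrite -size_cells big_const_seq count_predT iter_addn_0.
Qed.

(** Each radius is used by the two tour edges at its site, hence 38 = 2 * 19 per gadget; loose edges
    add 1/2 per gadget, and the error e is paid on each of the 9 L^2 edges. *)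
Lemma lattice_tour_ge (R : realFieldType) (c : site -> site -> R) (e : R) :
  (0 < L)%N ->
  {in s &, forall u v, u != v ->
    (site_r u + site_r v + loose u v)%N%:R - e <= c u v} ->
  38 * L%:R ^+ 2 + 2^-1 * L%:R ^+ 2 - 9 * L%:R ^+ 2 * e <= closed_length c s.
Proof.
move=> L0 cge; rewrite -sum_next//.
have ss : size s = (9 * L ^ 2)%N by rewrite (perm_size ps) size_lattice.
have s3 : (2 < size s)%N.
  by rewrite ss (@leq_trans (9 * 1)%N)// leq_mul2l /= expn_gt0 L0.
have nn u : u \in s -> u != next s u.
  move=> su; apply/eqP => eu; have := next_neq_prev us s3 su.
  by rewrite -eu {2}eu prev_next ?eqxx.
apply: (@le_trans _ _ (\sum_(u <- s)
   ((site_r u + site_r (next s u) + loose u (next s u))%N%:R - e))); last first.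
  rewrite big_seq [leRHS]big_seq; apply: ler_sum => u su.
  by apply: cge; rewrite ?mem_next// nn.
rewrite sumrB -natr_sum !big_split /=.
have -> : (\sum_(u <- s) site_r (next s u) = 19 * L ^ 2)%N.
  by rewrite -sum_site_r -[RHS](perm_big _ perm_map_next) big_map.
rewrite sum_site_r big_const_seq count_predT ss iter_addr_0.
have nL n : (n * L ^ 2)%N%:R = n%:R * L%:R ^+ 2 :> R by rewrite natrM natrX.
have : L%:R ^+ 2 <= 2 * (\sum_(u <- s) loose u (next s u))%N%:R :> R.
  by rewrite -natrX -natrM ler_nat loose_count.
move: (nL 19%N) (nL 9%N); move: (19 * L ^ 2)%N (9 * L ^ 2)%N => A B EA EB.
rewrite !natrD EA -[e *+ _]mulr_natl EB.
by set l := \sum_(u <- s) _; set q := L%:R ^+ 2; lra.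
Qed.

End LatticeTours.

(** * A short fractional tour of the lattice *)

Local Open Scope ring_scope.

(** Proof by enumeration: it lets the 2^9 cuts of a gadget be checked by computation. *)
Lemma bool_seqP n (P : pred (seq bool)) :
  all P (iter n (fun l => [seq x :: t | x <- [:: true; false], t <- l]) [:: [::]]) ->
  forall t, size t = n -> P t.
Proof.
move=> /allP Pt t tn; apply: Pt; elim: n t tn => [|n IH] [|x t] //= [tn].
rewrite cats0 mem_cat; apply/orP.
by case: x; [left|right]; apply: map_f; exact: IH.
Qed.

Section GadgetChain.
Context {R : realFieldType}.
Implicit Types (h : site -> site -> R) (a b : (nat * nat) * bool).

(* The flag tells in which direction the chain runs through the gadget; the
   gadget is entered and left at its sites 0 and 8. *)
Definition entry a : site := (a.1, if a.2 then 8%N else 0%N).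
Definition exit a : site := (a.1, if a.2 then 0%N else 8%N).

(** Weights are doubled to stay in the natural numbers: the triangle edges, of weight 1/2, appear
    with 1, and the cut condition becomes a bound by 4. *)
Definition gadget_weights : seq (nat * nat * nat) :=
  [:: (0, 1, 2); (1, 2, 1); (1, 3, 1); (2, 3, 1); (2, 4, 2); (3, 5, 2);
      (4, 6, 2); (5, 7, 2); (6, 7, 1); (6, 8, 1); (7, 8, 1)]%N.

Definition gadget_edges (c : nat * nat) : seq (site * site * R) :=
  [seq ((c, e.1.1), (c, e.1.2), e.2%:R / 2) | e <- gadget_weights].

Lemma gadget_fractional a :
  fractional_tour (gadget a.1) ((exit a, entry a, 1) :: gadget_edges a.1).
Proof.
pose w := (if a.2 then (0, 8, 2)%N else (8, 0, 2)%N) :: gadget_weights.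
pose w' : seq (nat * nat * R) := [seq (e.1.1, e.1.2, e.2%:R / 2) | e <- w].
have -> : (exit a, entry a, 1) :: gadget_edges a.1 =
   [seq ((a.1, e.1.1), (a.1, e.1.2), e.2) | e <- w'].
  rewrite /w' -map_comp /w [RHS]/=; congr (_ :: _).
  by rewrite /exit /entry; case: a.2; rewrite /= divff ?pnatr_eq0.
apply: (fractional_tour_map (f := fun k => (a.1, k))) => [? ? _ _ []//|].
have w9 e : e \in w -> (e.1.1 < 9)%N && (e.1.2 < 9)%N.
  move: e; apply/allP; by rewrite /w; case: a.2.
pose cut t := sumn [seq e.2 * (nth false t e.1.1 != nth false t e.1.2) | e <- w]%N.
have cutE (U : pred nat) : wsum w' (sep U) = (cut (map U (iota 0 9)))%:R / 2.
  rewrite /cut sumnE big_map natr_sum mulr_suml /wsum big_map.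
  apply: eq_big_seq => e /w9/andP[e1 e2].
  rewrite -[LHS]/(e.2%:R / 2 * sep U e.1.1 e.1.2).
  by rewrite !(nth_map 0%N) ?size_iota// !nth_iota// /sep natrM mulrAC.
split.
- move=> _ /mapP[e ew ->]; have /andP[e1 e2] := w9 e ew.
  by split; rewrite ?mem_iota//; exact: divr_ge0.
- move=> i i9; rewrite cutE.
  suff /eqP-> : cut (map (pred1 i) (iota 0 9)) == 4 by lra.
  by move: i i9; apply/allP; rewrite /cut /w; case: a.2.
- move=> U; have -> : has U (iota 0 9) = has id (map U (iota 0 9)) by rewrite has_map.
  have -> : has (predC U) (iota 0 9) = has negb (map U (iota 0 9)) by rewrite has_map.
  rewrite cutE; have : size (map U (iota 0 9)) = 9 by rewrite size_map size_iota.
  move: (map U _) => t t9 h1 h2.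
  suff : (4 <= cut t)%N.
    by rewrite -(ler_nat R) -[4%N]/(2 * 2)%N natrM ler_pdivlMr.
  have : (has id t && has negb t) ==> (4 <= cut t)%N.
    move: t t9 {h1 h2}; apply: bool_seqP; rewrite /cut /w.
    by case: a.2; vm_compute.
  by rewrite h1 h2.
Qed.

(** Splicing along the closing edges of weight 1 produces the link to the next gadget and the
    closing edge of the longer chain. The closing edge is kept out of [w], since insertion of the
    cluster will remove it. *)
Lemma chain_fractional a cs : uniq (map fst (a :: cs)) ->
  exists2 w, fractional_tour (flatten (map gadget (map fst (a :: cs))))
      ((exit (last a cs), entry a, 1) :: w) &
    forall h, wsum w h = \sum_(b <- a :: cs) wsum (gadget_edges b.1) h
      + path_length (fun b b' => h (exit b) (entry b')) a cs.
Proof.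
elim/last_ind: cs => [|cs b IH] ua.
  exists (gadget_edges a.1); last first.
    by move=> h; rewrite big_seq1 addr0.
  rewrite -[flatten _]/(gadget a.1 ++ [::]) cats0.
  exact: gadget_fractional.
move: ua; rewrite -rcons_cons map_rcons rcons_uniq => /andP[bcs uacs].
have [w fw wE] := IH uacs; exists ((exit (last a cs), entry b, 1) :: w ++ gadget_edges b.1).
  rewrite last_rcons.
  apply: (@fractional_tour_perm _ _ (flatten (map gadget (map fst (a :: cs))) ++ gadget b.1)).
    move=> u; rewrite mem_cat !mem_flatten_gadget mem_rcons inE mem_gadget.
    by rewrite -andb_orl orbC.
  have ne c : exit c != entry c by case: c => c []; rewrite /exit /entry xpair_eqE andbF.
  apply: fractional_tour_splice (gadget_fractional b) => //.
    move=> u; rewrite mem_flatten_gadget mem_gadget => /andP[u1 _].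
    by apply/negP => /andP[/eqP e _]; rewrite -e u1 in bcs.
  have [->|cs0] := eqVneq cs [::]; first exact: ne.
  apply: contraTneq uacs => /(congr1 fst) /= e; rewrite negb_and negbK -e map_f//.
  by case: (cs) cs0 => //= c cs' _; exact: mem_last.
move=> h; rewrite !wsum_cons wsum_cat wE mul1r big_rcons/=.
by rewrite path_length_rcons; ring.
Qed.

End GadgetChain.

Local Open Scope ring_scope.

Section Snake.
Context (l : nat).

(** Odd rows are run backwards, so that consecutive rows are linked at vertically aligned points. *)
Definition snake_cell (i j : nat) : (nat * nat) * bool :=
  ((i, if odd i then l - j else j)%N, odd i).

Fixpoint snake_tail (m : nat) : seq ((nat * nat) * bool) :=
  if m is m'.+1 then snake_tail m' ++ [seq snake_cell m j | j <- iota 0 l.+1]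
  else [seq snake_cell 0 j | j <- iota 1 l].

Definition snake (m : nat) := snake_cell 0 0 :: snake_tail m.

Lemma snake_tailS m :
  snake_tail m.+1 = snake_tail m ++ [seq snake_cell m.+1 j | j <- iota 0 l.+1].
Proof. by []. Qed.

Lemma size_snake m : size (snake m) = (m.+1 * l.+1)%N.
Proof.
elim: m => [|m IH]; first by rewrite /= size_map size_iota mul1n.
rewrite /snake snake_tailS -cat_cons size_cat IH size_map size_iota.
by rewrite [in RHS]mulSn addnC.
Qed.

Lemma mem_snake m i j : (i <= m)%N -> (j <= l)%N -> snake_cell i j \in snake m.
Proof.
elim: m => [|m IH] im jl.
  move: im; rewrite leqn0 => /eqP->.
  by rewrite -[snake 0]/(map (snake_cell 0) (iota 0 l.+1)) map_f// mem_iota.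
rewrite /snake snake_tailS -cat_cons mem_cat.
move: im; rewrite leq_eqVlt => /predU1P[->|im]; last by rewrite IH.
by rewrite [X in _ || X]map_f ?orbT// mem_iota.
Qed.

Lemma snake_cells : uniq (map fst (snake l)) /\ map fst (snake l) =i cells l.+1.
Proof.
have sub : {subset cells l.+1 <= map fst (snake l)}.
  move=> [i j]; rewrite mem_cells /= !ltnS => /andP[il jl].
  have jl' : ((if odd i then l - j else j) <= l)%N by case: ifP => // _; exact: leq_subr.
  have := map_f fst (mem_snake il jl').
  by rewrite /snake_cell /=; case: (odd i); rewrite ?subKn.
have sz : (size (map fst (snake l)) <= size (cells l.+1))%N.
  by rewrite size_map size_snake size_cells mulnn.
split; first exact: leq_size_uniq (cells_uniq _) sub sz.
by have [_ e] := uniq_min_size (cells_uniq _) sub sz; move=> x; rewrite e.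
Qed.

Lemma path_length_iota (R : realFieldType) (T : eqType) (F : T -> T -> R) (f : nat -> T)
    (A : R) a n :
  (forall j, (a <= j < a + n)%N -> F (f j) (f j.+1) <= A) ->
  path_length F (f a) (map f (iota a.+1 n)) <= A * n%:R.
Proof.
elim: n a => [|n IH] a FA /=; first by rewrite mulr0.
rewrite -natr1 mulrDr mulr1 addrC lerD//; last by apply: FA; lia.
by apply: IH => j jn; apply: FA; lia.
Qed.

Lemma last_map_iota (T : eqType) (f : nat -> T) a n :
  last (f a) (map f (iota a.+1 n)) = f (a + n)%N.
Proof. by elim: n a => [|n IH] a /=; rewrite ?addn0// IH addSnnS. Qed.

Lemma last_snake m : last (snake_cell 0 0) (snake_tail m) = snake_cell m l.
Proof.
by case: m => [|m] /=; rewrite ?last_cat /= last_map_iota.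
Qed.

Lemma snake_length (R : realFieldType) (F : (nat * nat) * bool -> (nat * nat) * bool -> R)
    (A B : R) m :
  (forall i j, (j < l)%N -> F (snake_cell i j) (snake_cell i j.+1) <= A) ->
  (forall i, F (snake_cell i l) (snake_cell i.+1 0) <= B) ->
  path_length F (snake_cell 0 0) (snake_tail m) <= A * (l * m.+1)%:R + B * m%:R.
Proof.
move=> FA FB; elim: m => [|m IH].
  by rewrite mulr0 addr0 muln1; apply: path_length_iota => j /andP[_]; exact: FA.
rewrite /= path_length_cat last_snake /=.
have row : path_length F (snake_cell m.+1 0) (map (snake_cell m.+1) (iota 1 l)) <= A * l%:R.
  by apply: path_length_iota => j /andP[_]; exact: FA.
have := FB m; move: IH row; rewrite !natrM -!natr1; lra.
Qed.

End Snake.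

Section LatticeFractional.
Context {R : realFieldType}.

(* The edges inside a gadget have weighted length 35; the edges between
   consecutive gadgets have length 3 inside a row and 13 from row to row. *)
Lemma lattice_fractional (l : nat) (h : site -> site -> R) (e : R) : 0 <= e ->
  (forall u v n, sqdist u v = (n ^ 2)%N -> h u v <= n%:R + e) ->
  exists w p q, [/\ p != q, fractional_tour (lattice l.+1) ((p, q, 1) :: w) &
    wsum w h <= 38 * l.+1%:R ^+ 2 + 10 * l.+1%:R + 9 * l.+1%:R ^+ 2 * e].
Proof.
move=> e0 hle.
have [us sE] := snake_cells l.
have [w fw wE] := chain_fractional (R := R) us.
exists w, (exit (last (snake_cell l 0 0) (snake_tail l l))), (entry (snake_cell l 0 0)); split.
- rewrite last_snake /exit /entry /=.
  by have [->|l0] := posnP l; rewrite ?xpair_eqE//= (gtn_eqF l0).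
- apply: fractional_tour_perm fw => u.
  by rewrite mem_flatten_gadget sE mem_lattice mem_cells andbA.
- rewrite wE.
  have cell c : wsum (gadget_edges c) h <= 35 + 8 * e.
    have hl k k' n : local_sqdist 0 k k' = (n ^ 2)%N -> h (c, k) (c, k') <= n%:R + e.
      by rewrite -(sqdist_same c) => /hle.
    rewrite /gadget_edges /gadget_weights /= !wsum_cons wsum_nil.
    have := hl 0%N 1%N 3%N erefl; have := hl 1%N 2%N 5%N erefl.
    have := hl 1%N 3%N 5%N erefl; have := hl 2%N 3%N 6%N erefl.
    have := hl 2%N 4%N 4%N erefl; have := hl 3%N 5%N 4%N erefl.
    have := hl 4%N 6%N 4%N erefl; have := hl 5%N 7%N 4%N erefl.
    have := hl 6%N 7%N 6%N erefl; have := hl 6%N 8%N 5%N erefl.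
    have := hl 7%N 8%N 5%N erefl; lra.
  have FA i j : (j < l)%N ->
      h (exit (snake_cell l i j)) (entry (snake_cell l i j.+1)) <= 3 + e.
    move=> jl; apply: (hle _ _ 3%N); rewrite /exit /entry /=.
    case: ifP => _; last by rewrite sqdist_next.
    by rewrite (subnS l j) -{1}(prednK (n := l - j)) ?subn_gt0// sqdistC sqdist_next.
  have FB i : h (exit (snake_cell l i l)) (entry (snake_cell l i.+1 0)) <= 13 + e.
    apply: (hle _ _ 13%N); rewrite /exit /entry /= subn0 subnn.
    case: (odd i) => /=;
    by rewrite /sqdist /site_x /site_y /= mulnS [(13 + _)%N]addnC -addnA /sqdiff; lia.
  have := @snake_length l R (fun b b' => h (exit b) (entry b')) _ _ l FA FB.
  rewrite natrM -!natr1.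
  have : \sum_(b <- snake_cell l 0 0 :: snake_tail l l) wsum (gadget_edges b.1) h
     <= (35 + 8 * e) * l.+1%:R ^+ 2.
    apply: (@le_trans _ _ (\sum_(b <- snake l l) (35 + 8 * e))); first exact: ler_sum.
    by rewrite big_const_seq count_predT size_snake iter_addr_0 -[leLHS]mulr_natr natrM expr2.
  (* With L = l + 1, the links have total length 3 l L + 13 l, at most 3 L^2 + 10 L; the 35 L^2 of
     the gadgets brings this to 38 L^2 + 10 L. *)
  rewrite -!natr1; set S := \sum_(_ <- _) _.
  have : 0 <= l%:R :> R by []; move: (l%:R) => x x0.
  nra.
Qed.

End LatticeFractional.

Section GapClusterMonotone.
Context {R : realFieldType} {I : eqType} (c : I -> I -> R).

Lemma gap_cluster_le (X : seq I) (v : I) (B : seq I) (g g' : R) :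
  g' <= g -> gap_cluster c X v B g -> gap_cluster c X v B g'.
Proof.
move=> gg gap V s d h1 h2 h3 h4 h5 h6 h7.
have [w fw wc] := gap V s d h1 h2 h3 h4 h5 h6 h7.
by exists w => //; lra.
Qed.

End GapClusterMonotone.

(** * Perturbed copies of the lattice in dimension d *)

Lemma sum_first_two (R : nmodType) (d : nat) (x y : R) : (2 <= d)%N ->
  \sum_(k < d) (if k == 0%N :> nat then x else if k == 1%N :> nat then y else 0)
  = x + y.
Proof.
case: d => [|[|d]] // _; rewrite !big_ord_recl big1 ?addr0// => k _.
Qed.

Definition sqdist2 (a b : nat * nat) : nat := sqdiff a.1 b.1 + sqdiff a.2 b.2.

Definition site_pos (u : site) : nat * nat := (site_x u, site_y u).

Lemma sqdist2_lattice L a b : (a.1 <= 22 * L)%N -> (a.2 <= 13 * L)%N ->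
  (b.1 <= 22 * L)%N -> (b.2 <= 13 * L)%N -> (sqdist2 a b <= (35 * L) ^ 2)%N.
Proof.
move=> a1 a2 b1 b2; rewrite /sqdist2.
have le m x y : (x <= m)%N -> (y <= m)%N -> (sqdiff x y <= m ^ 2)%N.
  move=> xm ym; rewrite /sqdiff; case: (leqP x y) => [|/ltnW] xy.
    by rewrite (eqP xy) add0n leq_sqr; apply: leq_trans (leq_subr _ _) ym.
  by rewrite (eqP xy) addn0 leq_sqr; apply: leq_trans (leq_subr _ _) xm.
apply: leq_trans (leq_add (le _ _ _ a1 b1) (le _ _ _ a2 b2)) _.
by rewrite !expnMn -mulnDl leq_mul2r orbT.
Qed.

Lemma site_pos_lattice L u : u \in lattice L ->
  ((site_pos u).1 <= 22 * L)%N /\ ((site_pos u).2 <= 13 * L)%N.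
Proof.
case: u => [[i j] k]; rewrite mem_lattice /site_pos /site_x /site_y /=.
by move=> /and3P[iL jL /gadget_bounds/and4P[kx ky _ _]]; split; lia.
Qed.

Section EmbeddedLattice.
Context {R : realType} {d : nat}.
Context (d_ge2 : (2 <= d)%N).

Definition planar (a : nat * nat) (k : 'I_d) : R :=
  if k == 0%N :> nat then a.1%:R else if k == 1%N :> nat then a.2%:R else 0.

Lemma sqr_sqdiff (a b : nat) : (a%:R - b%:R) ^+ 2 = (sqdiff a b)%:R :> R.
Proof.
wlog ab : a b / (b <= a)%N.
  by move=> wl; case: (leqP b a) => [|/ltnW] /wl//; rewrite sqdiffC -opprB sqrrN.
by rewrite -natrB// -natrX /sqdiff (eqP ab) addn0.
Qed.

Lemma enorm_planar a b :
  enorm (fun k => planar a k - planar b k) = Num.sqrt (sqdist2 a b)%:R.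
Proof.
congr Num.sqrt; rewrite /sqdist2 natrD -!sqr_sqdiff.
rewrite -(sum_first_two _ _ d_ge2); apply: eq_bigr => k _.
by rewrite /planar; case: ifP => // _; case: ifP => // _; rewrite subrr expr0n.
Qed.

Definition placed (o : 'I_d -> R) (t e : R) (a : nat * nat) (p : Rpoint R d) : Prop :=
  forall k, `|tnth p k - (o k + t * planar a k)| <= t * e.

Lemma placed_dist o t e a b p q : 0 < t ->
  placed o t e a p -> placed o t e b q ->
  `|eucl_dist p q - t * Num.sqrt (sqdist2 a b)%:R| <= t * (2 * d%:R * e).
Proof.
move=> t0 pa qb; have := enorm_le pa; have := enorm_le qb.
set P := fun k => tnth p k - _; set Q := fun k => tnth q k - _ => hQ hP.
have QN : enorm (fun k => -1 * Q k) = enorm Q by rewrite enormZ normrN1 mul1r.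
have PN : enorm (fun k => -1 * P k) = enorm P by rewrite enormZ normrN1 mul1r.
pose D k : R := planar a k - planar b k.
have DE : enorm (fun k => t * D k) = t * Num.sqrt (sqdist2 a b)%:R.
  by rewrite enormZ gtr0_norm// enorm_planar.
rewrite -DE eucl_distE ler_norml; apply/andP; split.
  have := enormD (fun k => tnth p k - tnth q k) (fun k => -1 * P k + Q k).
  have := enormD (fun k => -1 * P k) Q; rewrite PN.
  rewrite (@eq_enorm _ _ (fun k => _ - _ + _) (fun k => t * D k)); last first.
    by move=> k; rewrite /P /Q /D; ring.
  lra.
have := enormD (fun k => t * D k) (fun k => P k + -1 * Q k).
have := enormD P (fun k => -1 * Q k); rewrite QN.
rewrite (@eq_enorm _ _ (fun k => t * D k + _) (fun k => tnth p k - tnth q k)); last first.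
  by move=> k; rewrite /P /Q /D; ring.
lra.
Qed.

Lemma placed_dist_ge o t e a b p q n : 0 < t -> placed o t e a p -> placed o t e b q ->
  (n ^ 2 <= sqdist2 a b)%N -> t * (n%:R - 2 * d%:R * e) <= eucl_dist p q.
Proof.
move=> t0 pa qb nab.
have := placed_dist t0 pa qb; rewrite ler_norml => /andP[+ _].
have : n%:R <= Num.sqrt (sqdist2 a b)%:R :> R.
  by rewrite -(@ger0_norm _ n%:R)// -sqrtr_sqr ler_sqrt// -natrX ler_nat.
move=> h; have := h; rewrite -(ler_pM2l t0 n%:R) => {}h; lra.
Qed.

Lemma placed_dist_le o t e a b p q n : 0 < t -> placed o t e a p -> placed o t e b q ->
  (sqdist2 a b <= n ^ 2)%N -> eucl_dist p q <= t * (n%:R + 2 * d%:R * e).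
Proof.
move=> t0 pa qb nab.
have := placed_dist t0 pa qb; rewrite ler_norml => /andP[_].
have : Num.sqrt (sqdist2 a b)%:R <= n%:R :> R.
  by rewrite -(@ger0_norm _ n%:R)// -sqrtr_sqr ler_sqrt// -natrX ler_nat.
move=> h; have := h; rewrite -(ler_pM2l t0 _ n%:R) => {}h; lra.
Qed.

Definition direction_count : nat := #|{ffun 'I_d -> 'I_(4 * d).+1}|.

(* Large enough for the gap [L^2/2] of the lattice to beat the [O(L)] terms of
   [gap_clusterI]; locked, since conversion must not evaluate it. *)
Definition lattice_size : nat := locked (2 * (84 + 72 * direction_count.+1))%N.

Lemma lattice_size_gt0 : (0 < lattice_size)%N.
Proof. by rewrite /lattice_size -lock. Qed.

Lemma placed_gap_cluster (o : 'I_d -> R) (t e : R) (X : seq (Rpoint R d))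
    (v : Rpoint R d) (y : site -> Rpoint R d) (L := lattice_size) :
  0 < t -> 0 <= e -> 2 * d%:R * e * (36 * L%:R ^+ 2) <= 1 ->
  placed o t e (0, 0)%N v -> {in lattice L, forall u, placed o t e (site_pos u) (y u)} ->
  {in X, forall x, x \notin map y (lattice L) -> x != v -> {in lattice L, forall u,
     2 * (t * (36 * L%:R)) < eucl_dist x (y u)}} ->
  gap_cluster (@eucl_dist R d) X v (map y (lattice L)) t.
Proof.
move=> t0 e0 eL pv py far.
have L1 : 1 <= L%:R :> R by rewrite ler1n; exact: lattice_size_gt0.
set E := 2 * d%:R * e in eL *.
have E0 : 0 <= E by rewrite /E !mulr_ge0.
have E1 : E <= 1.
  apply: le_trans eL; rewrite ler_peMr//; nra.
have dge u w : u \in lattice L -> w \in lattice L -> u != w ->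
  t * ((site_r u + site_r w + ~~ tight u w)%N%:R - E) <= eucl_dist (y u) (y w).
  move=> uL wL uw; apply: placed_dist_ge (py u uL) (py w wL) _ => //.
  move: uL wL; rewrite !mem_lattice => /and3P[_ _ u9] /and3P[_ _ w9].
  exact: sqdist_ge.
have yI : {in lattice L &, injective y}.
  move=> u w uL wL yuw; apply/eqP/negPn/negP => uw.
  have := dge u w uL wL uw; rewrite yuw eucl_distxx.
  have : (2 <= site_r u + site_r w + ~~ tight u w)%N.
    move: uL wL; rewrite !mem_lattice => /and3P[_ _ u9] /and3P[_ _ w9].
    move: u9 w9 => /gadget_bounds/and4P[_ _ _ u0] /gadget_bounds/and4P[_ _ _ w0].
    by rewrite (leq_trans _ (leq_addr _ _))// (leq_add u0 w0).
  rewrite -(ler_nat R) => h; rewrite pmulr_rle0//; lra.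
have diam : {in map y (lattice L) &, forall i j, eucl_dist i j <= t * (36 * L%:R)}.
  move=> _ _ /mapP[u uL ->] /mapP[w wL ->].
  have [u1 u2] := site_pos_lattice uL; have [w1 w2] := site_pos_lattice wL.
  have := placed_dist_le t0 (py u uL) (py w wL) (sqdist2_lattice u1 u2 w1 w2).
  move=> /le_trans; apply; rewrite ler_pM2l// natrM -/E; lra.
have vB p : p \in map y (lattice L) -> eucl_dist v p <= t * (36 * L%:R).
  case/mapP => u uL ->; have [u1 u2] := site_pos_lattice uL.
  have := placed_dist_le t0 pv (py u uL) (@sqdist2_lattice L (0, 0)%N _ isT isT u1 u2).
  move=> /le_trans; apply; rewrite ler_pM2l// natrM -/E; lra.
(* The value 0 outside the lattice makes the upper bound on [h] hold for all sites, as
   [lattice_fractional] asks. *)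
pose h u w := if (u \in lattice L) && (w \in lattice L)
  then eucl_dist (y u) (y w) / t else 0.
have hle u w n : sqdist u w = (n ^ 2)%N -> h u w <= n%:R + E.
  rewrite /h; case: ifP => [/andP[uL wL] uw|_ _]; last by rewrite addr_ge0.
  rewrite ler_pdivrMr// mulrC; apply: placed_dist_le (py u uL) (py w wL) _ => //.
  by rewrite -uw.
have [l Ll] : exists l, L = l.+1.
  by exists L.-1; rewrite prednK//; exact: lattice_size_gt0.
have := lattice_fractional l E0 hle; rewrite -Ll => -[w [p [q [pq fw wle]]]].
have [wL _ _] := fw; have [/= pL qL _] := wL _ (mem_head _ _).
have fyw := fractional_tour_map yI fw.
set z := [seq (y i.1.1, y i.1.2, i.2) | i <- w].
have zle : wsum z (@eucl_dist R d)
    <= t * (38 * L%:R ^+ 2 + 10 * L%:R + 9 * L%:R ^+ 2 * E).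
  apply: le_trans (_ : t * wsum w h <= _); last by rewrite ler_pM2l.
  rewrite /z /wsum big_map mulr_sumr le_eqVlt; apply/orP; left; apply/eqP.
  apply: eq_big_seq => i iw; have [i1 i2 _] := wL i (mem_behead (s := _ :: _) iw).
  by rewrite /h i1 i2 /= mulrCA mulrC [t * _]mulrC mulfVK ?gt_eqF// mulrC.
have lge s : perm_eq s (map y (lattice L)) ->
    t * (38 * L%:R ^+ 2 + 2^-1 * L%:R ^+ 2 - 9 * L%:R ^+ 2 * E)
    <= closed_length (@eucl_dist R d) s.
  (* [f] inverts [y] on the lattice and turns a tour of the points into a tour of the sites. *)
  move=> ps; pose f p := nth ((0, 0), 0)%N (lattice L) (index p (map y (lattice L))).
  have yK : {in map y (lattice L), cancel f y}.
    by move=> a aL; rewrite /f -(nth_map _ (y ((0, 0), 0)%N)) ?nth_index// -(size_map y) index_mem.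
  have fK : {in lattice L, cancel y f}.
    move=> u uL; have yu : y u \in map y (lattice L) by exact: map_f.
    apply: yI => //; last exact: yK.
    by rewrite mem_nth// -(size_map y) index_mem.
  have pf : perm_eq (map f s) (lattice L).
    apply: perm_trans (perm_map f ps) _; rewrite -map_comp.
    rewrite (_ : [seq _ | u <- _] = lattice L)// -[RHS]map_id.
    by apply/eq_in_map => u uL /=; rewrite fK.
  have -> : s = map y (map f s).
    rewrite -map_comp -[LHS]map_id; apply/eq_in_map => a; rewrite (perm_mem ps) => aL.
    by rewrite /= yK.
  rewrite closed_length_map.
  have -> : closed_length (fun i j => eucl_dist (y i) (y j)) (map f s) =
      t * closed_length (fun i j => eucl_dist (y i) (y j) / t) (map f s).
    rewrite mulrC; case: (map f s) => [|i i1]; first by rewrite mul0r.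
    by rewrite /= path_lengthMr mulfVK ?gt_eqF.
  rewrite ler_pM2l//; apply: (lattice_tour_ge pf) => [|i j]; first exact: lattice_size_gt0.
  rewrite !(perm_mem pf) => iL jL ij; rewrite ler_pdivlMr// mulrC.
  exact: dge.
apply: gap_cluster_le (gap_clusterI _ _ _ _
  (cell := fun x => direction_cell (fun k => tnth x k - tnth (y p) k))
  diam _ _ fyw lge) => //.
- rewrite -/direction_count.
  have vp := vB _ (map_f y pL); have vq := vB _ (map_f y qL).
  have LE : L%:R = 2 * (84 + 72 * direction_count.+1%:R) :> R.
    by rewrite /L /lattice_size -lock natrM natrD natrM.
  set D : R := direction_count.+1%:R in LE *.
  move: zle vp vq => /= h1 h2 h3.
  (* In units of t, the gap is at least L^2/2 - 10 L - 1/2 from the two lengths, minus 72 L for the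
     edges at v, minus 72 D L for the entries. As L^2/2 = (84 + 72 D) L, at least 2 L - 1/2
     remains. *)
  have : t * (9 * L%:R ^+ 2 * E) <= t * 4^-1.
    by rewrite ler_pM2l//; lra.
  have : t * (1 : R) <= t * (2 * L%:R - 2^-1) by rewrite ler_pM2l//; lra.
  have : t * (L%:R * L%:R) = t * (L%:R * (2 * (84 + 72 * D))) by rewrite {2}LE.
  rewrite !expr2 in h1 *; lra.
- exact: eucl_dist_ge0.
- exact: eucl_distxx.
- exact: eucl_dist_sym.
- exact: eucl_dist_triangle.
- move=> i j iX jX iB jB iv jv _ cE; apply: same_direction_dist cE _ _; exact: far.
- by apply: contra_neq pq => ypq; exact: yI.
Qed.

End EmbeddedLattice.

(** * Boxes of the cube and the cells of a copy *)

Section Boxes.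
Context {R : realType} {d : nat} (g : nat).
Context (d_ge2 : (2 <= d)%N) (g_gt0 : (0 < g)%N).
Implicit Types (j : {ffun 'I_d -> 'I_g}) (a b : nat * nat).

Let L := @lattice_size d.

(* In units of the side of a box: the distance between neighbouring lattice
   coordinates, and the tolerance relative to it. *)
Definition mesh : R := (200 * L%:R)^-1.
Definition tolerance : R := (72 * d%:R * L%:R ^+ 2)^-1.

(** Half-open, so that distinct boxes are disjoint. *)
Definition box_side j k : set R := `[(j k)%:R / g%:R, (j k).+1%:R / g%:R[.

Definition center j k : R := ((j k)%:R + 2^-1) / g%:R.

Definition scale : R := mesh / g%:R.

Definition cell_side j a k : set R :=
  `[center j k + scale * (planar a k - tolerance),
    center j k + scale * (planar a k + tolerance)[.

Definition box j : set (Rpoint R d) := [set p | forall k, box_side j k (tnth p k)].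

Definition cell j a : set (Rpoint R d) := [set p | forall k, cell_side j a k (tnth p k)].

Definition small a := ((a.1 <= 22 * L)%N && (a.2 <= 13 * L)%N).

Lemma L_ge1 : 1 <= L%:R :> R. Proof. by rewrite ler1n; exact: lattice_size_gt0. Qed.

Lemma d_ge2R : 2 <= d%:R :> R. Proof. by rewrite ler_nat. Qed.

Lemma mesh_gt0 : 0 < mesh.
Proof. by have := L_ge1; rewrite invr_gt0; lra. Qed.

Lemma meshE : mesh * L%:R = 200^-1.
Proof. by have := L_ge1 => h; rewrite /mesh; field; rewrite gt_eqF//; lra. Qed.

Lemma tolerance_gt0 : 0 < tolerance.
Proof.
have := L_ge1; have := d_ge2R => h1 h2.
by rewrite invr_gt0 !mulr_gt0 ?exprn_gt0//; lra.
Qed.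

Lemma toleranceE : 2 * d%:R * tolerance * (36 * L%:R ^+ 2) = 1.
Proof.
have := L_ge1; have := d_ge2R => h1 h2.
by rewrite /tolerance; field; apply/andP; split; rewrite gt_eqF//; lra.
Qed.

Lemma tolerance_le : tolerance <= 4^-1.
Proof.
have e0 := tolerance_gt0; have := toleranceE; have L1 := L_ge1; have d2 := d_ge2R.
have LL : 1 <= L%:R ^+ 2 :> R by rewrite exprn_ege1.
have : tolerance * 2 <= tolerance * (d%:R * L%:R ^+ 2).
  by rewrite ler_pM2l// -[X in X <= _]mulr1 ler_pM.
lra.
Qed.

Lemma scale_gt0 : 0 < scale.
Proof. by rewrite divr_gt0 ?mesh_gt0// ltr0n. Qed.

Lemma planar_ge0 a (k : 'I_d) : 0 <= planar (R := R) a k.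
Proof. by rewrite /planar; case: ifP => // _; case: ifP. Qed.

Lemma planar_le a (k : 'I_d) : small a -> planar (R := R) a k <= 22 * L%:R.
Proof.
move=> /andP[a1 a2]; rewrite /planar; case: ifP => _.
  by rewrite -natrM ler_nat.
case: ifP => _; last by rewrite mulr_ge0.
by rewrite -natrM ler_nat (leq_trans a2)// leq_mul2r orbT.
Qed.

Lemma cell_placed j a p : cell j a p -> placed (center j) scale tolerance a p.
Proof.
move=> pa k; have := pa k; rewrite /cell_side /= in_itv /= => /andP[h1 h2].
rewrite ler_norml; apply/andP; split; lra.
Qed.

Lemma cell_bounds j a k : small a ->
  (j k)%:R / g%:R <= center j k + scale * (planar a k - tolerance) /\
  center j k + scale * (planar a k + tolerance) <= (j k).+1%:R / g%:R.
Proof.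
move=> sa; have h1 := planar_le k sa; have h2 := planar_ge0 a k.
have := tolerance_le; have := tolerance_gt0 => e0 e1.
have g0 : 0 < g%:R :> R by rewrite ltr0n.
rewrite /center /scale; set P := planar a k in h1 h2 *.
have cE x : ((j k)%:R + 2^-1) / g%:R + mesh / g%:R * x = ((j k)%:R + 2^-1 + mesh * x) / g%:R.
  by field; rewrite gt_eqF.
rewrite !cE; split; rewrite ler_pM2r ?invr_gt0//.
  have : mesh * P >= 0 by rewrite mulr_ge0// ltW// mesh_gt0.
  have : mesh * tolerance <= mesh * L%:R.
    by rewrite ler_pM2l ?mesh_gt0//; have := L_ge1; lra.
  rewrite meshE; lra.
rewrite -[(j k).+1%:R]natr1.
have : mesh * (P + tolerance) <= mesh * (23 * L%:R).
  by rewrite ler_pM2l ?mesh_gt0//; have := L_ge1; lra.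
rewrite mulrCA meshE; lra.
Qed.

Lemma cell_box j a : small a -> cell j a `<=` box j.
Proof.
move=> sa p pa k; have := pa k; rewrite /cell_side /box_side /= !in_itv /=.
have [l u] := cell_bounds j k sa; move=> /andP[c1 c2]; apply/andP; split.
  exact: le_trans c1.
exact: lt_le_trans u.
Qed.

(** In units of the side, every coordinate of a cell lies between 99/200 and 123/200, so the margin
    is at least 77/200, more than the required 72/200. *)
Lemma cell_far j a p x : small a -> cell j a p -> ~ box j x ->
  2 * (scale * (36 * L%:R)) < eucl_dist x p.
Proof.
move=> sa pa xj; have [k xk] : exists k, ~ box_side j k (tnth x k).
  by apply: contrapT => h; apply: xj => k; apply: contrapT => hk; apply: h; exists k.
apply: lt_le_trans (enorm_coord (fun k => tnth x k - tnth p k) k).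
have := pa k; move: xk; rewrite /cell_side /box_side /= !in_itv /=.
have h1 := planar_le k sa; have h2 := planar_ge0 a k.
have := tolerance_le; have := tolerance_gt0 => e0 e1.
have g0 : 0 < g%:R :> R by rewrite ltr0n.
rewrite /center /scale; set P := planar a k in h1 h2 *.
have cE y : ((j k)%:R + 2^-1) / g%:R + mesh / g%:R * y = ((j k)%:R + 2^-1 + mesh * y) / g%:R.
  by field; rewrite gt_eqF.
rewrite !cE => + /andP[c1 c2].
have -> : 2 * (mesh / g%:R * (36 * L%:R)) = 72 * 200^-1 / g%:R.
  by rewrite -meshE; field; rewrite gt_eqF.
have {}c1 : ((j k)%:R + 2^-1 - 200^-1) / g%:R <= tnth p k.
  apply: le_trans c1; rewrite ler_pM2r ?invr_gt0//.
  have : mesh * P >= 0 by rewrite mulr_ge0// ltW// mesh_gt0.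
  have : mesh * tolerance <= mesh * L%:R.
    by rewrite ler_pM2l ?mesh_gt0//; have := L_ge1; lra.
  rewrite meshE; lra.
have {}c2 : tnth p k <= ((j k)%:R + 2^-1 + 23 / 200) / g%:R.
  apply: le_trans (ltW c2) _; rewrite ler_pM2r ?invr_gt0//.
  have : mesh * (P + tolerance) <= mesh * (23 * L%:R).
    by rewrite ler_pM2l ?mesh_gt0//; have := L_ge1; lra.
  rewrite mulrCA meshE; lra.
move/negP; rewrite negb_and -!real_ltNge ?num_real// => /orP[h|h].
- rewrite distrC; apply: lt_le_trans (ler_norm _).
  have : (j k)%:R / g%:R + 72 / 200 / g%:R < ((j k)%:R + 2^-1 - 200^-1) / g%:R :> R.
    have : 0 < g%:R^-1 :> R by rewrite invr_gt0.
    move: (g%:R^-1) => G G0. lra.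
  lra.
- move: h; rewrite -leNgt => h; apply: lt_le_trans (ler_norm _).
  have : ((j k)%:R + 2^-1 + 23 / 200) / g%:R + 72 / 200 / g%:R < (j k).+1%:R / g%:R :> R.
    rewrite -[(j k).+1%:R]natr1; have : 0 < g%:R^-1 :> R by rewrite invr_gt0.
    move: (g%:R^-1) => G G0; lra.
  lra.
Qed.

(** The first two coordinates of a and b are integers, and p determines them up to twice the
    tolerance, hence up to 1/2. *)
Lemma cell_inj j a b p : cell j a p -> cell j b p -> a = b.
Proof.
move=> pa pb.
have close (k : 'I_d) : `|planar a k - planar b k| < 1 :> R.
  have := cell_placed pa k; have := cell_placed pb k.
  rewrite !ler_norml => /andP[b1 b2] /andP[a1 a2].
  have s0 := scale_gt0; have := tolerance_le => e1.
  have se : scale * tolerance <= scale * 4^-1 by rewrite ler_pM2l.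
  rewrite -(ltr_pM2l s0) -[X in X * `|_|]gtr0_norm// -normrM mulr1.
  rewrite ltr_norml; apply/andP; split; lra.
have natE (m n : nat) : `|m%:R - n%:R| < 1 :> R -> m = n.
  wlog mn : m n / (n <= m)%N.
    by move=> wl; case: (leqP n m) => [/wl//|/ltnW/wl + h]; rewrite distrC => /(_ h).
  rewrite -natrB// normr_nat -[1]/(1%:R) ltr_nat => nm; lia.
have d0 : (0 < d)%N by exact: ltn_trans d_ge2.
have := close (Ordinal d0); have := close (Ordinal d_ge2).
by rewrite /planar /= => /natE e2 /natE e1; case: a b e1 e2 {pa pb close} => [? ?] [? ?] /= -> ->.
Qed.

Lemma box_inj j j' p : box j p -> box j' p -> j = j'.
Proof.
move=> pj pj'; apply/ffunP => k.
have := pj k; have := pj' k; rewrite /box_side /= !in_itv /= => /andP[a1 a2] /andP[b1 b2].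
have g0 : 0 < g%:R^-1 :> R by rewrite invr_gt0 ltr0n.
have := le_lt_trans a1 b2; have := le_lt_trans b1 a2.
rewrite !ltr_pM2r// !ltr_nat !ltnS => h1 h2.
by apply/val_inj/eqP; rewrite eqn_leq h1 h2.
Qed.

End Boxes.

Lemma site_pos_inj L : {in lattice L &, injective site_pos}.
Proof.
move=> u w; rewrite !mem_lattice => /and3P[_ _ u9] /and3P[_ _ w9] e.
apply/eqP/negPn/negP => uw; have := sqdist_ge u9 w9 uw.
case: e => eX eY; rewrite /sqdist eX eY /sqdiff !subnn.
by move: u9 => /gadget_bounds/and4P[_ _ _]; rewrite /site_r; case: gadget_r.
Qed.

Lemma site_pos_neq0 u : (u.2 < 9)%N -> site_pos u != (0, 0)%N.
Proof.
have h : all (fun k => (gadget_x k, gadget_y k) != (0, 0)%N) (iota 0 9) by [].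
move=> u9; have := allP h u.2; rewrite mem_iota => /(_ u9).
rewrite /site_pos /site_x /site_y !xpair_eqE !addn_eq0.
by apply: contra => /andP[]/andP[_ ->]/andP[_ ->].
Qed.

(** * Copies of the lattice in a sample *)

Section Sample.
Context {R : realType} {d : nat} (g : nat).
Context (d_ge2 : (2 <= d)%N) (g_ge2 : (2 <= g)%N).

Let L := @lattice_size d.
Let g_gt0 : (0 < g)%N := ltnW g_ge2.

(** The leading [(0, 0)] is the position of the point v at which the copy is attached; no site of
    the lattice lies there. *)
Definition cluster_points : seq (nat * nat) := (0, 0)%N :: map site_pos (lattice L).

Definition cluster_size : nat := (size (lattice L)).+1.

Local Notation m := cluster_size.
Local Notation b := (g ^ d)%N.

Implicit Types (j : {ffun 'I_d -> 'I_g}) (f : {ffun 'I_m -> 'I_b})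
  (jf : {ffun 'I_d -> 'I_g} * {ffun 'I_m -> 'I_b}).

Definition slot f (k : nat) : nat := (k * b + f (inord k))%N.

(* The sample is cut into m blocks of b points; [f] selects in each block the
   point that lies in the corresponding cell of box [j], and all the others
   must avoid the box. *)
Definition target j f (i : nat) : set (Rpoint R d) :=
  if (i == slot f (i %/ b))%N then cell (R := R) j (nth (0, 0)%N cluster_points (i %/ b))
  else ~` box j.

Definition realized (x : nat -> Rpoint R d) j f : Prop :=
  forall i, (i < m * b)%N -> target j f i (x i).

Lemma b_gt0 : (0 < b)%N. Proof. by rewrite expn_gt0 g_gt0. Qed.

Lemma b_ge2 : (2 <= b)%N.
Proof.
apply: leq_trans (_ : g ^ 1 <= _)%N; first by rewrite expn1.
by rewrite leq_pexp2l// (ltn_trans _ d_ge2).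
Qed.

Lemma slot_div f k : (slot f k %/ b = k)%N.
Proof. by rewrite /slot divnMDl ?b_gt0// divn_small ?addn0. Qed.

Lemma slot_lt f k : (k < m)%N -> (slot f k < m * b)%N.
Proof.
move=> km; apply: leq_trans (_ : k.+1 * b <= _)%N; last by rewrite leq_mul2r km orbT.
by rewrite mulSn addnC /slot ltn_add2l.
Qed.

Lemma cluster_points_small a : a \in cluster_points -> small (d := d) a.
Proof.
rewrite inE => /predU1P[->//|/mapP[u uL ->]].
by have [h1 h2] := site_pos_lattice uL; rewrite /small h1 h2.
Qed.

Section Realized.
Context (x : nat -> Rpoint R d).

Lemma realized_cell j f k : realized x j f -> (k < m)%N ->
  cell j (nth (0, 0)%N cluster_points k) (x (slot f k)).
Proof.
move=> r km; have := r _ (slot_lt f km).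
by rewrite /target slot_div eqxx.
Qed.

Lemma realized_box j f k : realized x j f -> (k < m)%N -> box j (x (slot f k)).
Proof.
move=> r km; apply: cell_box (realized_cell r km) => //.
by apply: cluster_points_small; rewrite mem_nth// /cluster_points /= size_map.
Qed.

Lemma realized_out j f i : realized x j f -> (i < m * b)%N ->
  i != slot f (i %/ b) -> ~ box j (x i).
Proof. by move=> r im ne; have := r i im; rewrite /target (negbTE ne). Qed.

(** The points that are not selected avoid the box, so the box determines the selection. Realized
    pairs thus correspond to distinct boxes. *)
Lemma realized_inj j f f' : realized x j f -> realized x j f' -> f = f'.
Proof.
move=> r r'; apply/ffunP => k; apply/val_inj/eqP/negPn/negP => ne.
apply: (realized_out r' (slot_lt f (ltn_ord k))) (realized_box r (ltn_ord k)).
rewrite slot_div /slot eqn_add2l.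
by rewrite inord_val.
Qed.

Definition sample : {fset Rpoint R d} := [fset x (val i) | i in 'I_(m * b)]%fset.

Lemma sampleP p : reflect (exists2 i, (i < m * b)%N & p = x i) (p \in sample).
Proof.
apply: (iffP (imfsetP _ _ _ _)) => [[i _ ->]|[i im ->]].
  by exists (val i); first exact: ltn_ord.
by exists (Ordinal im).
Qed.

Let vertex jf : Rpoint R d := x (slot jf.2 0).
Let member jf (u : site) : Rpoint R d := x (slot jf.2 (index u (lattice L)).+1).
Let members jf := map (member jf) (lattice L).

Let member_cell jf u : realized x jf.1 jf.2 -> u \in lattice L ->
  cell jf.1 (site_pos u) (member jf u).
Proof.
move=> r uL; have um : ((index u (lattice L)).+1 < m)%N by rewrite ltnS index_mem.
have := realized_cell r um; rewrite /cluster_points /= (nth_map ((0, 0), 0)%N) ?index_mem//.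
by rewrite nth_index.
Qed.

Let member_box jf p : realized x jf.1 jf.2 -> p \in members jf -> box jf.1 p.
Proof.
move=> r /mapP[u uL ->]; apply: realized_box => //.
by rewrite ltnS index_mem.
Qed.

Let members_uniq jf : realized x jf.1 jf.2 -> uniq (members jf).
Proof.
move=> r; rewrite map_inj_in_uniq ?lattice_uniq// => u w uL wL e.
have h1 := member_cell r uL; have h2 := member_cell r wL.
by rewrite e in h1; apply: (site_pos_inj uL wL); exact: cell_inj h1 h2.
Qed.

Let vertex_member jf : realized x jf.1 jf.2 -> vertex jf \notin members jf.
Proof.
move=> r; apply/mapP => -[u uL e].
have := member_cell r uL; rewrite -e => h1.
have := realized_cell r (ltn0Sn _); rewrite -/(vertex jf) => h2.
have := cell_inj d_ge2 g_gt0 h1 h2; apply/eqP.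
by move: uL; rewrite mem_lattice => /and3P[_ _ /site_pos_neq0].
Qed.

Lemma realized_gap (gs : seq ({ffun 'I_d -> 'I_g} * {ffun 'I_m -> 'I_b})) :
  uniq gs -> gs != [::] -> (forall jf, jf \in gs -> realized x jf.1 jf.2) ->
  HK sample + @scale R d g *+ size gs <= TSP sample.
Proof.
move=> ugs gs0 rgs.
pose cl := [seq (vertex jf, members jf) | jf <- gs].
pose B := flatten (map members gs).
have clE : unzip2 cl = map members gs by rewrite /unzip2 -map_comp.
pose A := [seq p <- sample | p \notin B].
have box_eq jf jf' (p : Rpoint R d) :
    jf \in gs -> jf' \in gs -> box jf.1 p -> box jf'.1 p -> jf = jf'.
  case: jf jf' => [j f] [j' f'] /rgs/= r /rgs/= r' jp j'p.
  rewrite -(box_inj g_gt0 jp j'p) in r' *.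
  by rewrite (realized_inj r r').
have vertexB jf : jf \in gs -> vertex jf \notin B.
  move=> jfg; apply/flatten_mapP => -[jf' jfg' vB].
  have := member_box (rgs _ jfg') vB.
  have vb : box jf.1 (vertex jf) by apply: realized_box => //; exact: rgs.
  move=> /(box_eq _ _ _ jfg jfg' vb) e; rewrite -e in vB.
  by have := vertex_member (rgs _ jfg); rewrite vB.
have vertexA jf : jf \in gs -> vertex jf \in A.
  move=> jfg; rewrite mem_filter vertexB//=; apply/sampleP.
  by exists (slot jf.2 0) => //; exact: slot_lt.
have uB : uniq B.
  rewrite /B; elim: gs ugs rgs box_eq {gs0 cl B clE A vertexB vertexA} => //= jf gs IH.
  case/andP => jfg ugs rgs box_eq.
  rewrite cat_uniq members_uniq ?IH//= ?andbT; last 3 first.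
  - by move=> jf' jf'g; apply: rgs; rewrite inE jf'g orbT.
  - by move=> jf1 jf2 p j1 j2; apply: box_eq; rewrite inE ?j1 ?j2 orbT.
  - by apply: rgs; rewrite mem_head.
  apply/hasPn => p /flatten_mapP[jf' jf'g pm]; apply/negP => /= pm'.
  have jf'g2 : jf' \in jf :: gs by rewrite inE jf'g orbT.
  have := box_eq _ _ _ (mem_head _ _) jf'g2 (member_box (rgs _ (mem_head _ _)) pm')
    (member_box (rgs _ jf'g2) pm).
  by move=> e; rewrite e jf'g in jfg.
have Bsample : {subset B <= sample}.
  move=> p /flatten_mapP[jf jfg /mapP[u uL ->]]; apply/sampleP.
  by exists (slot jf.2 (index u (lattice L)).+1) => //; rewrite slot_lt// ltnS index_mem.
have uA : uniq A by rewrite filter_uniq ?fset_uniq.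
have uAB : uniq (A ++ B).
  rewrite cat_uniq uA uB andbT /=; apply/hasPn => p pB.
  by rewrite mem_filter pB.
have ABE : A ++ B =i sample.
  move=> p; rewrite mem_cat mem_filter; case: (boolP (p \in B)) => [/Bsample->|_];
    by rewrite /= ?orbT ?orbF.
have [jf0 jf0g] : exists jf, jf \in gs.
  by case: (gs) gs0 => // jf gs' _; exists jf; exact: mem_head.
(* A point of the first block that is not selected lies outside the box. If it is not in A itself,
   it belongs to the copy in another box, whose vertex is then a second point of A. *)
have A2 : (1 < size A)%N.
  have [q qA qv] : exists2 q, q \in A & q != vertex jf0.
    have [r rb r0] : exists2 r, (r < b)%N & r != jf0.2 (inord 0).
      have [e|ne] := eqVneq (0%N : nat) (jf0.2 (inord 0)).
        by exists 1%N; [exact: b_ge2 | rewrite -e].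
      by exists 0%N; [exact: b_gt0 |].
    have rm : (r < m * b)%N by rewrite (leq_trans rb)// leq_pmull.
    have out : ~ box jf0.1 (x r).
      apply: (realized_out (rgs _ jf0g) rm).
      by rewrite divn_small// /slot mul0n add0n.
    have vb : box jf0.1 (vertex jf0) by apply: realized_box => //; exact: rgs.
    have [xB|xB] := boolP (x r \in B); last first.
      exists (x r); first by rewrite mem_filter xB; apply/sampleP; exists r.
      by apply/eqP => e; apply: out; rewrite e.
    have /flatten_mapP[jf jfg xm] := xB.
    exists (vertex jf); first exact: vertexA.
    apply/eqP => e; apply: out; have := member_box (rgs _ jfg) xm.
    have -> // : jf = jf0; apply: (box_eq _ _ (vertex jf)) => //.
      by apply: realized_box => //; exact: rgs.
    by rewrite e.
  have := uniq_leq_size (s1 := [:: q; vertex jf0]) (s2 := A).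
  by apply; rewrite /= ?inE ?qv// => p; rewrite !inE => /orP[]/eqP->//; exact: vertexA.
have [s ps opt] := ex_optimal_tour (@eucl_dist R d) (A ++ B).
have us : uniq s by rewrite (perm_uniq ps).
have sX : perm_eq s sample.
  by apply: perm_trans ps _; apply: uniq_perm => //; exact: fset_uniq.
apply: (HK_TSP_gap (s := s)) => //.
  rewrite -(perm_size sX) (perm_size ps) size_cat.
  have : (0 < size B)%N.
    have : (0 < size (members jf0))%N.
      by rewrite size_map size_lattice muln_gt0 expn_gt0 lattice_size_gt0.
    case E : (members jf0) => [|p ps'] // _.
    have : p \in B by apply/flatten_mapP; exists jf0 => //; rewrite E mem_head.
    by case: (B).
  exact: leq_add A2.
have [w fw wle] : fractional_le (@eucl_dist R d) (A ++ flatten (unzip2 cl))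
    (closed_length (@eucl_dist R d) s - scale (R := R) (d := d) g *+ size cl).
  apply: (@gap_clusters _ _ _ _ sample); rewrite ?clE//.
  - by move=> p; rewrite ABE.
  - move=> _ /mapP[jf jfg ->] /=; split; first exact: vertexA.
    have r := rgs _ jfg.
    apply: (@placed_gap_cluster _ _ d_ge2 (center jf.1) _ (tolerance (R := R) (d := d))).
    + exact: scale_gt0.
    + exact/ltW/tolerance_gt0.
    + by rewrite toleranceE.
    + exact: cell_placed (realized_cell r (ltn0Sn _)).
    + by move=> u uL; exact: cell_placed (member_cell r uL).
    (* A sample point that is neither v nor in the copy is not selected, so it is outside the box
       and [cell_far] applies. *)
    + move=> p /sampleP[i im ->] iB iv u uL.
      have sm : small (d := d) (site_pos u).
        by have [h1 h2] := site_pos_lattice uL; rewrite /small h1 h2.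
      apply: cell_far sm (member_cell r uL) _ => //.
      apply: (realized_out r im); apply/eqP => e.
      have im' : (i %/ b < m)%N by rewrite ltn_divLR ?b_gt0.
      move: iB iv; rewrite e; case: (i %/ b)%N im' => [|k km].
        by rewrite eqxx.
      move=> /negP[]; apply/mapP; exists (nth ((0, 0), 0)%N (lattice L) k).
        exact: mem_nth.
      by rewrite /member index_uniq// lattice_uniq.
rewrite /cl size_map in wle; exists w => //.
by apply: fractional_tour_perm fw; rewrite clE.
Qed.

End Realized.
End Sample.

(** * Probability and expected proportion of copies *)

Lemma uniform_prob_itv (R : realType) (a b : R) : 0 <= a -> a <= b -> b <= 1 ->
  uniform_prob (@ltr01 R) `[a, b[ = (b - a)%:E.
Proof.
move=> a0 ab b1; rewrite /uniform_prob.
rewrite (eq_integral (cst 1%E)) => [|x].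
  rewrite integral_cst// mul1e.
  rewrite -[LHS]/(lebesgue_measure [set` `[a, b[]) lebesgue_measure_itv /= lte_fin.
  by case: ltgtP ab => // -> _; rewrite subrr.
rewrite inE /= in_itv /= => /andP[ax xb].
by rewrite /uniform_pdf subr0 invr1 (le_trans a0 ax) (ltW (lt_le_trans xb b1)).
Qed.

Lemma measurable_rectangle (R : realType) (d : nat)
    (B : 'I_d -> set (measurableTypeR R)) :
  (forall k, measurable (B k)) ->
  measurable [set p : Rpoint R d | forall k, B k (tnth p k)].
Proof.
move=> mB.
have -> : [set p : Rpoint R d | forall k, B k (tnth p k)]
    = \bigcap_(k in [set: 'I_d]) ((fun p : Rpoint R d => tnth p k) @^-1` B k).
  by apply/seteqP; split=> [p h k _|p h k]; exact: h.
apply: fin_bigcap_measurable => // k _.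
by rewrite -[X in measurable X]setTI; apply: measurable_tnth.
Qed.

Lemma big_blocks (R : comPzRingType) (m b : nat) (s : nat -> nat) (c e : R) :
  (forall k, (k < m)%N -> (s k < b)%N) ->
  \prod_(0 <= i < m * b) (if i == (i %/ b * b + s (i %/ b))%N then c else e)
  = (c * e ^+ b.-1) ^+ m.
Proof.
move=> sb; rewrite big_nat_mul -{2}(card_ord m) -prodr_const big_mkord.
apply: eq_bigr => -[k km] _ /=; have skb := sb k km.
rewrite -[X in \big[_/_]_(X <= _ < _) _]add0n mulSn big_addn addnK big_mkord.
rewrite (bigD1 (Ordinal skb))//= addnC divnMDl ?(leq_trans _ skb)// divn_small// addn0 eqxx.
congr (_ * _); rewrite (eq_bigr (fun=> e)) => [|i ne].
  by rewrite prodr_const cardC1 card_ord.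
rewrite [(i + _)%N]addnC divnMDl ?(leq_trans _ skb)// divn_small// addn0 eqn_add2l.
by case: eqP => // h; case/negP: ne; apply/eqP/val_inj.
Qed.

Section Probability.
Context {R : realType} {d : nat} (g : nat).
Context (d_ge2 : (2 <= d)%N) (g_ge2 : (2 <= g)%N).
Context {disp : measure_display} {T : measurableType disp} (P : probability T R).
Context (x : nat -> {mfun T >-> Rpoint R d}).
Context (x_unif : forall i, uniform_on_cube P (x i)) (x_indep : mutually_independent P x).

Let g_gt0 : (0 < g)%N := ltnW g_ge2.
Local Notation m := (@cluster_size d).
Local Notation b := (g ^ d)%N.

Implicit Types (j : {ffun 'I_d -> 'I_g}) (f : {ffun 'I_m -> 'I_b})
  (jf : {ffun 'I_d -> 'I_g} * {ffun 'I_m -> 'I_b}).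

Lemma measurable_box j : measurable (box (R := R) j).
Proof. by apply: measurable_rectangle => k; exact: measurable_itv. Qed.

Lemma measurable_cell j a : measurable (cell (R := R) j a).
Proof. by apply: measurable_rectangle => k; exact: measurable_itv. Qed.

Lemma measurable_target j f i : measurable (target (R := R) j f i).
Proof.
rewrite /target; case: ifP => _; first exact: measurable_cell.
by apply: measurableC; exact: measurable_box.
Qed.

Lemma box_side_subset j k : (j k)%:R / g%:R >= 0 :> R /\ (j k).+1%:R / g%:R <= 1 :> R.
Proof.
split; first by rewrite divr_ge0.
by rewrite ler_pdivrMr ?ltr0n// mul1r ler_nat.
Qed.

Lemma box_prob j i : P (x i @^-1` box j) = (b%:R^-1)%:E.
Proof.
rewrite -[LHS]/(distribution P (x i) (box j)) x_unif => [|k]; last exact: measurable_itv.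
rewrite (eq_bigr (fun=> (g%:R^-1)%:E)) => [|k _].
  by rewrite prodEFin prodr_const card_ord exprVn natrX.
have [h1 h2] := box_side_subset j k.
rewrite uniform_prob_itv//; last by rewrite ler_pM2r ?invr_gt0 ?ltr0n// ler_nat.
by rewrite -mulrBl -natr1 addrAC subrr add0r mul1r.
Qed.

Definition cell_volume : R := (2 * @scale R d g * @tolerance R d) ^+ d.

Lemma cell_prob j a i : small (d := d) a -> P (x i @^-1` cell j a) = cell_volume%:E.
Proof.
move=> sa.
rewrite -[LHS]/(distribution P (x i) (cell j a)) x_unif => [|k]; last exact: measurable_itv.
rewrite (eq_bigr (fun=> (2 * @scale R d g * @tolerance R d)%:E)) => [|k _].
  by rewrite prodEFin prodr_const card_ord.
have [h1 h2] := box_side_subset j k; have [l u] := cell_bounds (R := R) d_ge2 g_gt0 j k sa.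
have s0 := @scale_gt0 R d g g_gt0; have t0 := @tolerance_gt0 R d d_ge2.
rewrite uniform_prob_itv.
- by congr EFin; ring.
- exact: le_trans l.
- rewrite lerD2l ler_pM2l//; lra.
- exact: le_trans h2.
Qed.

Definition sample_indices : {fset nat} := [fset i in iota 0 (m * b)]%fset.

Definition event jf : set T :=
  \bigcap_(i in [set` sample_indices]) (x i @^-1` target jf.1 jf.2 i).

Lemma eventP jf w : event jf w <-> realized (fun i => x i w) jf.1 jf.2.
Proof.
split=> [h i im|h i /=]; first by apply: h; rewrite /= !inE mem_iota.
by rewrite !inE mem_iota => /h.
Qed.

Lemma measurable_event jf : measurable (event jf).
Proof.
apply: fin_bigcap_measurable => // i _.
rewrite -[X in measurable X]setTI; apply: (measurable_funPT (x i)) => //.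
exact: measurable_target.
Qed.

Lemma event_prob jf : P (event jf) = ((cell_volume * (1 - b%:R^-1) ^+ b.-1) ^+ m)%:E.
Proof.
case: jf => j f; rewrite /event x_indep => [|i]; last exact: measurable_target.
have pI : perm_eq sample_indices (iota 0 (m * b)).
  apply: uniq_perm; rewrite ?fset_uniq ?iota_uniq// => i.
  by rewrite !inE.
rewrite (perm_big _ pI) /= -[X in iota _ X]subn0 -/(index_iota 0 (m * b)).
rewrite -(@big_blocks R m b (fun k => f (inord k))) => [|k _]; last exact: ltn_ord.
rewrite -prodEFin; apply: eq_big_nat => i /andP[_ im].
rewrite /target /slot; case: ifP => _.
  apply: cell_prob; apply: cluster_points_small; apply: mem_nth.
  by rewrite /cluster_points /= size_map ltn_divLR// expn_gt0 g_gt0.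
rewrite -preimage_setC probability_setC ?box_prob//.
rewrite -[X in measurable X]setTI; apply: (measurable_funPT (x i)) => //.
exact: measurable_box.
Qed.

End Probability.

(** The right-hand side is the inverse of (1 + 1/n)^n, which is at most e. With n + 1 boxes, it
    bounds the probability that n points avoid a given box. *)
Lemma expRN1_le (R : realType) (n : nat) : expR (-1) <= (1 - n.+1%:R^-1) ^+ n :> R.
Proof.
case: n => [|n]; first by rewrite expr0 -[leRHS]expR0 ler_expR oppr_le0.
have n0 : 0 < n.+1%:R :> R by rewrite ltr0n.
have -> : 1 - n.+2%:R^-1 = (1 + n.+1%:R^-1)^-1 :> R.
  by rewrite -(natr1 n.+1); field; rewrite !gt_eqF//; lra.
have p0 : 0 < 1 + n.+1%:R^-1 :> R by rewrite addr_gt0// invr_gt0.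
rewrite expRN exprVn lef_pV2 ?posrE ?expR_gt0 ?exprn_gt0//.
apply: le_trans (_ : expR n.+1%:R^-1 ^+ n.+1 <= _); last first.
  by rewrite -expRM_natl mulfV ?gt_eqF.
by rewrite ler_pXn2r ?nnegrE ?expR_ge0 ?expR_ge1Dx// ltW.
Qed.

Section Frequency.
Context {R : realType} {d : nat} (g : nat).
Context (d_ge2 : (2 <= d)%N) (g_ge2 : (2 <= g)%N).
Context {disp : measure_display} {T : measurableType disp} (P : probability T R).
Context (x : nat -> {mfun T >-> Rpoint R d}).
Context (x_unif : forall i, uniform_on_cube P (x i)) (x_indep : mutually_independent P x).

Local Notation m := (@cluster_size d).
Local Notation b := (g ^ d)%N.
Local Notation index := ({ffun 'I_d -> 'I_g} * {ffun 'I_m -> 'I_b})%type.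

(** At most one selection is realized per box, so this is the proportion of boxes that contain a
    copy. *)
Definition frequency (w : T) : R := (\sum_(jf : index) \1_(event x jf) w) / b%:R.

Let b_gt0 : 0 < b%:R :> R.
Proof. by rewrite ltr0n expn_gt0 ltnW. Qed.

Lemma frequency_count w : exists gs : seq index,
  [/\ uniq gs, frequency w = (size gs)%:R / b%:R &
      forall jf, jf \in gs -> realized (fun i => x i w) jf.1 jf.2].
Proof.
exists [seq jf <- enum {: index} | w \in event x jf]; split.
- by rewrite filter_uniq ?enum_uniq.
- congr (_ / _); rewrite size_filter -sum1_count natr_sum big_enum_cond /=.
  by rewrite [RHS]big_mkcond; apply: eq_bigr => jf _; rewrite indicE; case: ifP.
- by move=> jf; rewrite mem_filter => /andP[/set_mem/eventP].
Qed.

Lemma frequency_ge0 w : 0 <= frequency w.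
Proof. by rewrite divr_ge0// sumr_ge0. Qed.

Lemma frequency_le1 w : frequency w <= 1.
Proof.
have [gs [ugs -> rgs]] := frequency_count w.
rewrite ler_pdivrMr// mul1r ler_nat.
have ufst : uniq (map fst gs).
  rewrite map_inj_in_uniq// => -[j f] [j' f'] /rgs/= r /rgs/= r' jj.
  by rewrite -{j'}jj in r' *; rewrite (realized_inj d_ge2 g_ge2 r r').
have : (size (map fst gs) <= #|{ffun 'I_d -> 'I_g}|)%N.
  by rewrite -(card_uniqP ufst) max_card.
by rewrite size_map card_ffun !card_ord.
Qed.

Let mindic (jf : index) : measurable_fun [set: T] (fun w => (\1_(event x jf) w : R)%:E).
Proof. exact/measurable_EFinP/measurable_indic/measurable_event. Qed.

Lemma frequencyE w : ((frequency w)%:E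
  = (b%:R^-1)%:E * \sum_(jf : index) (\1_(event x jf) w : R)%:E)%E.
Proof. by rewrite /frequency mulrC EFinM sumEFin. Qed.

Lemma measurable_frequency : measurable_fun [set: T] (EFin \o frequency).
Proof.
rewrite (_ : EFin \o _ = fun w =>
    ((b%:R^-1)%:E * \sum_(jf : index) (\1_(event x jf) w : R)%:E)%E).
  by apply: measurable_funeM; apply: emeasurable_sum.
by apply/funext => w /=; exact: frequencyE.
Qed.

Definition hit_rate : R := (2 * @mesh R d * @tolerance R d) ^+ d.

Lemma hit_rate_gt0 : 0 < hit_rate.
Proof. by rewrite exprn_gt0// !mulr_gt0 ?mesh_gt0 ?tolerance_gt0. Qed.

Lemma integral_frequency :
  (((hit_rate * expR (-1)) ^+ m)%:E <= \int[P]_w (frequency w)%:E)%E.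
Proof.
have -> : (\int[P]_w (frequency w)%:E =
  ((hit_rate * (1 - b%:R^-1) ^+ b.-1) ^+ m)%:E)%E.
  under eq_integral do rewrite frequencyE.
  rewrite ge0_integralZl//=; last 2 first.
  - exact: emeasurable_sum.
  - by move=> w _; apply: sume_ge0 => jf _; rewrite lee_fin.
  rewrite ge0_integral_sum//=.
  have E (jf : index) : (\int[P]_w (\1_(event x jf) w)%:E)%E
      = ((@cell_volume R d g * (1 - b%:R^-1) ^+ b.-1) ^+ m)%:E.
    rewrite integral_indic//; last exact: measurable_event.
    by rewrite setIT; exact: event_prob.
  rewrite (eq_bigr _ (fun jf _ => E jf)).
  rewrite sumEFin -EFinM sumr_const card_prod !card_ffun !card_ord.
  (* There are b * b^m events. The factor b cancels against the normalization, and b^m turns each of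
     the m cell volumes into [hit_rate], which does not depend on g. *)
  congr EFin; rewrite -(mulr_natl (_ ^+ m)) natrM [(b ^ m)%:R]natrX mulrA mulKf; last first.
    by rewrite gt_eqF.
  rewrite -exprMn mulrA; congr ((_ * _) ^+ _).
  rewrite /cell_volume /hit_rate /scale natrX -exprMn; congr (_ ^+ _).
  by field; rewrite pnatr_eq0 -lt0n ltnW.
have b1 : 0 <= 1 - b%:R^-1 :> R.
  by rewrite subr_ge0 invf_le1// ler1n -(ltr_nat R).
rewrite lee_fin; apply: lerXn2r; rewrite ?nnegrE.
- exact: mulr_ge0 (ltW hit_rate_gt0) (expR_ge0 _).
- exact: mulr_ge0 (ltW hit_rate_gt0) (exprn_ge0 _ b1).
rewrite ler_pM2l ?hit_rate_gt0//.
have -> : b%:R = b.-1.+1%:R :> R by rewrite prednK// -(ltr_nat R).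
exact: expRN1_le.
Qed.

End Frequency.

Lemma natr_powR_dim (R : realType) (d m g : nat) : (0 < d)%N ->
  (m * g ^ d)%:R `^ ((d%:R - 1) / d%:R)
  = m%:R `^ ((d%:R - 1) / d%:R) * g%:R ^+ d.-1 :> R.
Proof.
move=> d0; have dn0 : d%:R != 0 :> R by rewrite pnatr_eq0 -lt0n.
rewrite natrM powRM//; congr (_ * _).
rewrite natrX -(powR_mulrn d (ler0n R g)) -powRrM mulrC divfK//.
by rewrite -[X in X%:R - 1](prednK d0) -natr1 addrK powR_mulrn.
Qed.

Section FrequencyBound.
Context {R : realType} {d : nat} (g : nat).
Context (d_ge2 : (2 <= d)%N) (g_ge2 : (2 <= g)%N).
Context {disp : measure_display} {T : measurableType disp}.
Context (x : nat -> {mfun T >-> Rpoint R d}).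
Local Notation m := (@cluster_size d).
Local Notation theta := ((d%:R - 1) / d%:R : R).

(** The maximum with 0 covers the samples without a copy, where [realized_gap] says nothing. The
    constant does not depend on g, since scale times the number of boxes is mesh times g^(d-1). *)
Lemma frequency_le w (n := (m * g ^ d)%N) :
  frequency g x w <= Num.max 0
    (m%:R `^ theta / @mesh R d *
      ((TSP (first_points x n w) - HK (first_points x n w)) / n%:R `^ theta)).
Proof.
have [gs [ugs -> rgs]] := frequency_count g x w.
have [->|gs0] := eqVneq gs [::]; first by rewrite mul0r le_max lexx.
rewrite le_max; apply/orP; right.
have g0 : 0 < g%:R :> R by rewrite ltr0n ltnW.
have d0 : (0 < d)%N by exact: ltnW.
have m0 : 0 < m%:R `^ theta :> R by rewrite powR_gt0.
have mesh0 := @mesh_gt0 R d.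
have : HK (first_points x n w) + @scale R d g *+ size gs <= TSP (first_points x n w).
  exact: realized_gap ugs gs0 rgs.
rewrite /n natr_powR_dim//.
set D1 := TSP _; set D2 := HK _; rewrite -mulr_natr => DD.
have -> : m%:R `^ theta / @mesh R d * ((D1 - D2) / (m%:R `^ theta * g%:R ^+ d.-1))
   = (D1 - D2) / (@mesh R d * g%:R ^+ d.-1).
  by field; rewrite !gt_eqF ?exprn_gt0.
rewrite ler_pdivlMr ?mulr_gt0 ?exprn_gt0//.
apply: le_trans (_ : @scale R d g * (size gs)%:R <= _); last by lra.
rewrite le_eqVlt; apply/orP; left; apply/eqP.
rewrite /scale natrX.
have -> : g%:R ^+ d = g%:R * g%:R ^+ d.-1 :> R by rewrite -exprS prednK.
field.
by rewrite !gt_eqF ?exprn_gt0.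
Qed.

End FrequencyBound.

(** * Passage to the limit *)

Lemma cvg_sample_size (d : nat) (m : nat) : (0 < m)%N -> (0 < d)%N ->
  (fun k => m * k.+2 ^ d)%N @ \oo --> \oo.
Proof.
move=> m0 d0; apply/cvgnyPge => A; near=> k.
have kA : (A <= k)%N by near: k; exact: nbhs_infty_ge.
apply: leq_trans kA _.
apply: leq_trans (_ : k.+2 ^ d <= _)%N; last by rewrite leq_pmull.
apply: leq_trans (_ : k.+2 ^ 1 <= _)%N; last by rewrite leq_pexp2l.
by rewrite expn1 ltnW// ltnW.
Unshelve. all: by end_near.
Qed.

Theorem theorem1p8 (R : realType) (d : nat) (d_ge2 : (2 <= d)%N)
    (disp : measure_display) (T : measurableType disp) (P : probability T R)
    (x : nat -> {mfun T >-> Rpoint R d})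
    (x_unif : forall i : nat, uniform_on_cube P (x i))
    (x_indep : mutually_independent P x)
    (beta_TSP beta_HK : R)
    (beta_TSPP : is_beta P (@TSP R d) x beta_TSP)
    (beta_HKP : is_beta P (@HK R d) x beta_HK) :
  (beta_HK < beta_TSP)%R.
Proof.
rewrite ltNge; apply/negP => bb.
have d0 : (0 < d)%N by exact: ltnW.
(* The shift by 2 provides the two boxes per side that the sampling argument asks for. *)
pose F (k : nat) (w : T) : \bar R := (frequency k.+2 x w)%:E.
have mF k : measurable_fun [set: T] (F k) by exact: measurable_frequency.
have F0 : {ae P, forall w, [set: T] w -> F ^~ w @ \oo --> 0%E}.
  apply: filterS2 beta_TSPP beta_HKP => w tT tH _.
  have := cvgB (cvg_comp _ _ (cvg_sample_size (ltn0Sn _ : (0 < @cluster_size d)%N) d0) tT)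
     (cvg_comp _ _ (cvg_sample_size (ltn0Sn _ : (0 < @cluster_size d)%N) d0) tH).
  set u := (X in X @ _ --> _) => tu.
  have C0 : 0 < (@cluster_size d)%:R `^ ((d%:R - 1) / d%:R) / @mesh R d.
    by rewrite divr_gt0 ?mesh_gt0// powR_gt0.
  set C := _ / _ in C0.
  have fu k : frequency k.+2 x w <= Num.max 0 (C * u k).
    apply: le_trans (frequency_le d_ge2 (isT : (1 < k.+2)%N) x w) _.
    by rewrite [leLHS](_ : _ = Num.max 0 (C * u k))//; congr (Num.max 0 (C * _)); exact: mulrBl.
  have : C * (beta_TSP - beta_HK) <= 0 by rewrite pmulr_rle0// subr_le0.
  have tCu : C * u k @[k --> \oo] --> C * (beta_TSP - beta_HK).
    by apply: cvgM; [exact: cvg_cst|exact: tu].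
  (* The limit is only known to be at most 0; this is enough, because the frequency lies between 0
     and a maximum with 0. *)
  move=> l0.
  apply: cvg_EFin; first by near=> k.
  apply/cvgrPdist_lt => e e0; near=> k.
  rewrite /= sub0r normrN ger0_norm ?frequency_ge0//.
  apply: le_lt_trans (fu k) _; rewrite gt_max e0 /=.
  by near: k; apply: (cvgr_lt _ tCu); exact: le_lt_trans e0.
have int1 : P.-integrable [set: T] (cst 1%E) by exact: finite_measure_integrable_cst.
have F1 : {ae P, forall w n, [set: T] w -> (`|F n w| <= cst 1 w)%E}.
  apply: aeW => w n _.
  by rewrite /F /= lee_fin ger0_norm ?frequency_ge0// frequency_le1.
have [_ _] := dominated_convergence measurableT mF (measurable_cst 0%E) F0 int1 F1.
rewrite integral0 => tI.
set p := (@hit_rate R d * expR (-1)) ^+ @cluster_size d.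
have : (p%:E <= 0)%E.
  by apply: (cvge_ge _ tI); near=> k; exact: integral_frequency.
by rewrite lee_fin leNgt exprn_gt0// mulr_gt0 ?expR_gt0// hit_rate_gt0.
Unshelve. all: by end_near.
Qed.
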